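(* Let $d\geq 3$. Assume that the family of measures $\mathbb P^u$, $u\in(a,b)$, satisfies assumptions P1, P2, P3, S1, S2 (listed in the context). Let $u\in(a,b)$, and let $\Omega_{\mathrm{hk}}$ and $T_{\mathrm{hk}}(x)$, $x\in\mathbb Z^d$, be the event and the random variables of the quenched heat kernel bounds described in the context. There exist constants $C_i=C_i(u)$, $i=1,2,3$, such that for all $\omega\in\Omega_{\mathrm{hk}}$ and distinct $x,y\in\mathcal S_\infty(\omega)$, if $$d_{\mathbb Z^d}(x,y)^2\geq\min\{T_{\mathrm{hk}}(x),T_{\mathrm{hk}}(y)\}\cdot\left(1+C_3\cdot\log d_{\mathbb Z^d}(x,y)\right),$$ then $$C_1\cdot d_{\mathbb Z^d}(x,y)^{2-d}\leq g_{\mathcal S_\infty(\omega)}(x,y)\leq C_2\cdot d_{\mathbb Z^d}(x,y)^{2-d}.$$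
   Context: **Model.** Let $|x|_1,|x|_\infty$ be the $\ell^1$ and $\ell^\infty$ norms and $\mathrm B(x,r)=\{y\in\mathbb Z^d:|x-y|_\infty\le\lfloor r\rfloor\}$. Let $\Omega=\{0,1\}^{\mathbb Z^d}$ with the $\sigma$-algebra $\mathcal F$ generated by the coordinate maps. For $\omega\in\Omega$ let $\mathcal S=\mathcal S(\omega)=\{x\in\mathbb Z^d:\omega(x)=1\}$, viewed as a graph with edges between vertices at $\ell^1$-distance $1$. For $r\in[0,\infty]$, $\mathcal S_r$ is the set of vertices of $\mathcal S$ lying in connected components of $\mathcal S$ of $\ell^1$-diameter $\ge r$; in particular $\mathcal S_\infty$ is the set of vertices in infinite components (considered as a subgraph of $\mathcal S$). An event $G\in\mathcal F$ is increasing (resp. decreasing) if $\omega\in G$ and $\omega(y)\le\omega'(y)$ (resp. $\omega(y)\ge\omega'(y)$) for all $y$ imply $\omega'\in G$. Fix $0<a<b<\infty$ and a family $(\mathbb P^u)_{u\in(a,b)}$ of probability measures on $(\Omega,\mathcal F)$. The assumptions are: P1 (ergodicity): for each $u\in(a,b)$ every lattice shift is measure preserving and ergodic on $(\Omega,\mathcal F,\mathbb P^u)$. P2 (monotonicity): for $u<u'$ in $(a,b)$ and any increasing $G\in\mathcal F$, $\mathbb P^u[G]\le\mathbb P^{u'}[G]$. P3 (decoupling): there exist $R_P,L_P<\infty$, $\epsilon_P,\chi_P>0$ and a real valued function $f_P$ with $f_P(L)\ge e^{(\log L)^{\epsilon_P}}$ for all $L\ge L_P$, such that for every integer $L\ge1$,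 $x_1,x_2\in\mathbb Z^d$, decreasing events $A_i$ and increasing events $B_i$ in $\sigma(\omega(y):y\in\mathrm B(x_i,10L))$, $i=1,2$, every integer $R\ge R_P$ and $a<\widehat u<u<b$ with $u\ge(1+R^{-\chi_P})\widehat u$: if $|x_1-x_2|_\infty\ge RL$ then $\mathbb P^u[A_1\cap A_2]\le\mathbb P^{\widehat u}[A_1]\mathbb P^{\widehat u}[A_2]+e^{-f_P(L)}$ and $\mathbb P^{\widehat u}[B_1\cap B_2]\le\mathbb P^{u}[B_1]\mathbb P^{u}[B_2]+e^{-f_P(L)}$. S1 (local uniqueness): there is $f_S:(a,b)\times\mathbb Z_+\to\mathbb R$ such that for each $u\in(a,b)$ there exist $\Delta_S=\Delta_S(u)>0$ and $R_S=R_S(u)<\infty$ with $f_S(u,R)\ge(\log R)^{1+\Delta_S}$ for all $R\ge R_S$, and for all $u\in(a,b)$, $R\ge1$: $\mathbb P^u[\mathcal S_R\cap\mathrm B(0,R)\ne\emptyset]\ge1-e^{-f_S(u,R)}$ and $\mathbb P^u[\text{all }x,y\in\mathcal S_{R/10}\cap\mathrm B(0,R)\text{ are connected in }\mathcal S\cap\mathrm B(0,2R)]\ge1-e^{-f_S(u,R)}$. S2 (continuity): $\eta(u)=\mathbb P^u[0\in\mathcal S_\infty]$ is positive and continuous on $(a,b)$. If the family $(\mathbb P^u)_{u\in(a,b)}$ satisfies P1, P2, P3, S1 and S2, then for every $u\in(a,b)$ the set $\mathcal S_\infty$ is $\mathbb P^u$-a.s. non-empty and connected. Dependence of constants on $d$,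 $a$, $b$ and on $\epsilon_P,\chi_P,\Delta_S$ is not indicated; constants are positive and finite. **Random walks and Green function.** $d_G$ denotes graph distance on a graph $G$ ($d_{\mathbb Z^d}$ is the $\ell^1$-distance). On $G=\mathcal S_\infty(\omega)$ let $\mu_x$ be the degree of $x$, $X$ the discrete time simple random walk (law $\mathrm P_x$) and $Y$ the continuous time simple random walk with mean one exponential holding times and uniform jumps to neighbors (law $\mathrm Q_x$); $p_n(x,y)=\mathrm P_x[X_n=y]/\mu_y$, $q_t(x,y)=\mathrm Q_x[Y_t=y]/\mu_y$, and $g_G(x,y)=\int_0^\infty q_t(x,y)\,dt=\sum_{n\ge0}p_n(x,y)$. **Quenched heat kernel bounds.** If $d\ge2$, the family $(\mathbb P^u)_{u\in(a,b)}$ of probability measures on $(\Omega,\mathcal F)$ satisfies P1 (ergodicity), P2 (monotonicity), P3 (decoupling), S1 (local uniqueness) and S2 (continuity), and $u\in(a,b)$, then there exist, and we fix, $\Omega_{\mathrm{hk}}\in\mathcal F$ with $\mathbb P^u[\Omega_{\mathrm{hk}}]=1$, constants $c_1,\dots,c_4,c,C\in(0,\infty)$ depending only on $u$, and random variables $T_{\mathrm{hk}}(x)$, $x\in\mathbb Z^d$, such that for all $\omega\in\Omega_{\mathrm{hk}}$ and $x\in\mathcal S_\infty(\omega)$: $T_{\mathrm{hk}}(x,\omega)<\infty$; for all $t\ge T_{\mathrm{hk}}(x,\omega)$ and $y\in\mathcal S_\infty(\omega)$, $F_t(x,y)\le c_1t^{-d/2}e^{-c_2\mathrm D(x,y)^2/t}$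 if $t\ge\mathrm D(x,y)$, and $F_t(x,y)\ge c_3t^{-d/2}e^{-c_4\mathrm D(x,y)^2/t}$ if $t\ge\mathrm D(x,y)^{3/2}$, where $F_t$ stands for either $q_t$ or $p_{\lfloor t\rfloor}+p_{\lfloor t\rfloor+1}$ and $\mathrm D$ for either $d_{\mathcal S_\infty(\omega)}$ or $d_{\mathbb Z^d}$; and $\mathbb P^u[T_{\mathrm{hk}}(z)\ge r]\le Ce^{-c(\log r)^{1+\Delta_S}}$ for all $z\in\mathbb Z^d$, $r\ge1$. *)

(* Defs.v *)
From HB Require Import structures.
From mathcomp Require Import all_boot all_order all_algebra.
From mathcomp Require Import finmap.
From mathcomp Require Import all_classical all_reals all_analysis.
From mathcomp Require Import measurable_realfun.

Set Implicit Arguments.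
Unset Strict Implicit.
Unset Printing Implicit Defensive.

Import Order.TTheory GRing.Theory Num.Theory.
Import numFieldNormedType.Exports.

Local Open Scope classical_set_scope.
Local Open Scope ring_scope.

Definition Zd (d : nat) := 'rV[int]_d.

Definition dist1 d (x y : Zd d) : nat :=
  (\sum_(i < d) `|(x ord0 i - y ord0 i)%R|)%N.

Definition distoo d (x y : Zd d) : nat :=
  (\max_(i < d) `|(x ord0 i - y ord0 i)%R|)%N.

Definition ball_oo (R : realType) d (x : Zd d) (r : R) : set (Zd d) :=
  [set y | (distoo x y)%:Z <= Num.floor r].

Definition coord_events d (D : set (Zd d)) : set (set (Zd d -> bool)) :=
  \bigcup_(y in D) preimage_set_system setT (fun w => w y) (@measurable _ bool).

Notation Omega d := (g_sigma_algebraType (@coord_events d setT)).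

Definition adj d (x y : Zd d) : bool := dist1 x y == 1%N.

(* x :: s is a nearest neighbour path from x to y that stays in A; it has
   size s edges. *)
Definition is_path d (A : set (Zd d)) (x y : Zd d) (s : seq (Zd d)) : Prop :=
  [/\ path (@adj d) x s, last x s = y & forall z, z \in x :: s -> A z].

Definition connected_in d (A : set (Zd d)) (x y : Zd d) : Prop :=
  exists s, is_path A x y s.

Definition component d (A : set (Zd d)) (x : Zd d) : set (Zd d) :=
  [set y | connected_in A x y].

Definition diam1 (R : realType) d (A : set (Zd d)) : \bar R :=
  ereal_sup [set (dist1 z.1 z.2)%:R%:E | z in A `*` A].

Definition degree d (G : set (Zd d)) (x : Zd d) : nat :=
  (#|` fset_set [set z | G z /\ adj x z]|)%fset.

(* Equal to +oo when x and y are not connected in G. *)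
Definition graph_dist (R : realType) d (G : set (Zd d)) (x y : Zd d) : \bar R :=
  ereal_inf [set (size s)%:R%:E | s in is_path G x y].

Definition S_ d (w : Omega d) : set (Zd d) := [set x | w x].

Definition S_r (R : realType) d (r : \bar R) (w : Omega d) : set (Zd d) :=
  [set x | S_ w x /\ (r <= diam1 R (component (S_ w) x))%E].

(* Components of infinite l1-diameter are the infinite components, because
   balls of Z^d are finite. *)
Definition S_oo (R : realType) d (w : Omega d) : set (Zd d) :=
  @S_r R d +oo%E w.

Definition shift d (x : Zd d) (w : Omega d) : Omega d := fun y => w (y + x).

Definition increasing_event d (A : set (Omega d)) : Prop :=
  forall w w' : Omega d, A w -> (forall y, (w y <= w' y)%N) -> A w'.

Definition decreasing_event d (A : set (Omega d)) : Prop :=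
  forall w w' : Omega d, A w -> (forall y, (w' y <= w y)%N) -> A w'.

Definition local_event d (D : set (Zd d)) : set (set (Omega d)) :=
  <<s coord_events D >>.

(* The shift by 0 is the identity map, which is ergodic only for trivial
   measures, so ergodicity is about the nonzero shifts. *)
Definition P1 (R : realType) d (a b : R) (P : R -> probability (Omega d) R) :=
  forall u, a < u < b -> forall x : Zd d,
    (forall A : set (Omega d), measurable A ->
       P u (shift x @^-1` A) = P u A) /\
    (x != 0 -> forall A : set (Omega d), measurable A ->
       shift x @^-1` A = A -> P u A = 0%E \/ P u A = 1%E).

Definition P2 (R : realType) d (a b : R) (P : R -> probability (Omega d) R) :=
  forall u u', a < u -> u < u' -> u' < b ->
  forall A : set (Omega d), measurable A -> increasing_event A ->
    (P u A <= P u' A)%E.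

Definition P3 (R : realType) d (a b : R) (P : R -> probability (Omega d) R) :=
  exists (RP LP eps chi : R) (fP : nat -> R),
    [/\ 0 < RP, 0 < LP, 0 < eps & 0 < chi] /\
    (forall L : nat, LP <= L%:R -> expR (ln L%:R `^ eps) <= fP L) /\
    (forall (L : nat) (x1 x2 : Zd d) (A1 A2 B1 B2 : set (Omega d))
        (K : nat) (uh u : R),
      (1 <= L)%N ->
      local_event (ball_oo x1 (10 * L%:R : R)) A1 -> decreasing_event A1 ->
      local_event (ball_oo x2 (10 * L%:R : R)) A2 -> decreasing_event A2 ->
      local_event (ball_oo x1 (10 * L%:R : R)) B1 -> increasing_event B1 ->
      local_event (ball_oo x2 (10 * L%:R : R)) B2 -> increasing_event B2 ->
      RP <= K%:R ->
      a < uh -> uh < u -> u < b ->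
      (1 + K%:R `^ (- chi)) * uh <= u ->
      (K * L <= distoo x1 x2)%N ->
      (P u (A1 `&` A2) <= P uh A1 * P uh A2 + (expR (- fP L))%:E)%E /\
      (P uh (B1 `&` B2) <= P u B1 * P u B2 + (expR (- fP L))%:E)%E).

Definition existence_event (R : realType) d (K : nat) : set (Omega d) :=
  [set w | S_r (K%:R : R)%:E w `&` ball_oo 0 (K%:R : R) !=set0].

Definition uniqueness_event (R : realType) d (K : nat) : set (Omega d) :=
  [set w | forall x y : Zd d,
    (S_r (K%:R / 10 : R)%:E w `&` ball_oo 0 (K%:R : R)) x ->
    (S_r (K%:R / 10 : R)%:E w `&` ball_oo 0 (K%:R : R)) y ->
    connected_in (S_ w `&` ball_oo 0 (2 * K%:R : R)) x y].

(* The exponent DeltaS is a parameter, not an existential, because it also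
   occurs in the tail bound of the heat kernel estimates. *)
Definition S1 (R : realType) d (a b : R) (P : R -> probability (Omega d) R)
    (DeltaS : R -> R) :=
  exists fS : R -> nat -> R,
    (forall u, a < u < b -> 0 < DeltaS u /\
       exists RS : R, 0 < RS /\ forall K : nat, RS <= K%:R ->
         ln K%:R `^ (1 + DeltaS u) <= fS u K) /\
    (forall u, a < u < b -> forall K : nat, (1 <= K)%N ->
      ((1 - expR (- fS u K))%:E <= P u (@existence_event R d K))%E /\
      ((1 - expR (- fS u K))%:E <= P u (@uniqueness_event R d K))%E).

Definition eta (R : realType) d (P : R -> probability (Omega d) R) (u : R) : R :=
  fine (P u [set w | @S_oo R d w 0]).

Definition S2 (R : realType) d (a b : R) (P : R -> probability (Omega d) R) :=
  forall u, a < u < b -> 0 < eta P u /\ {for u, continuous (eta P)}.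

Definition step (R : realType) d (G : set (Zd d)) (x y : Zd d) : R :=
  if `[< G x /\ G y >] && adj x y then (degree G x)%:R^-1 else 0.

(* Simple random walk on G started at x, through the law of its finite
   trajectories. *)
Definition is_srw (R : realType) d dT (T : measurableType dT) (G : set (Zd d))
    (x : Zd d) (P : probability T R) (X : nat -> T -> Zd d) : Prop :=
  (forall n z, measurable (X n @^-1` [set z])) /\
  (forall n (s : nat -> Zd d),
    P [set o | forall k, (k <= n)%N -> X k o = s k] =
    ((s 0%N == x)%:R * \prod_(k < n) step R G (s k) (s k.+1))%:E).

(* The jump chain Z and the holding times E of Y have the joint law of a simple
   random walk and an independent sequence of independent exponential variables
   of mean one. The path of Y is prescribed almost surely only, so that it is
   arbitrary on explosions. *)
Definition is_ctsrw (R : realType) d dT (T : measurableType dT)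
    (G : set (Zd d)) (x : Zd d) (Q : probability T R) (Y : R -> T -> Zd d) :
    Prop :=
  (forall t z, 0 <= t -> measurable (Y t @^-1` [set z])) /\
  exists (Z : nat -> T -> Zd d) (E : nat -> T -> R),
    [/\ forall n z, measurable (Z n @^-1` [set z]),
        forall n, measurable_fun setT (E n),
        forall n (s : nat -> Zd d) (B : nat -> set R),
          (forall k, measurable (B k)) ->
          (Q [set o | forall k, (k <= n)%N -> Z k o = s k /\ B k (E k o)] =
           ((s 0%N == x)%:R * \prod_(k < n) step R G (s k) (s k.+1))%:E *
           \prod_(k < n.+1) exponential_prob 1%R (B k))%E
      & {ae Q, forall o, forall t n, 0 <= t ->
          \sum_(k < n) E k o <= t -> t < \sum_(k < n.+1) E k o ->
          Y t o = Z n o}].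

Section kernels.
Variables (R : realType) (d : nat) (dT : measure_display).
Variables (T : measurableType dT) (G : set (Zd d)) (P : Zd d -> probability T R).

Definition p_kernel (X : nat -> T -> Zd d) (n : nat) (x y : Zd d) : R :=
  fine (P x (X n @^-1` [set y])) / (degree G y)%:R.

Definition q_kernel (Y : R -> T -> Zd d) (t : R) (x y : Zd d) : R :=
  fine (P x (Y t @^-1` [set y])) / (degree G y)%:R.

Definition green (Y : R -> T -> Zd d) (x y : Zd d) : \bar R :=
  (\int[lebesgue_measure]_(t in `[0%R, +oo[) (q_kernel Y t x y)%:E)%E.

End kernels.

(* The two Gaussian bounds at time t for the value F of a heat kernel at two
   points of distance D; both are void for D = +oo. *)
Definition gaussian_bounds (R : realType) (d : nat) (c1 c2 c3 c4 t F : R)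
    (D : \bar R) : Prop :=
  ((D <= t%:E)%E ->
     F <= c1 * t `^ (- (d%:R / 2)) * expR (- (c2 * fine D ^+ 2 / t))) /\
  ((poweR D (3 / 2)%R <= t%:E)%E ->
     c3 * t `^ (- (d%:R / 2)) * expR (- (c4 * fine D ^+ 2 / t)) <= F).

(* Here p w and q w are the heat kernels of the discrete and the continuous
   time walk on S_oo w, P is the measure of parameter u and Delta is the
   value of DeltaS at u. Thk is not assumed to be positive, whereas the bounds
   make sense at positive times only. *)
Definition quenched_hk_bounds (R : realType) (d : nat)
    (P : probability (Omega d) R) (Delta : R)
    (p : Omega d -> nat -> Zd d -> Zd d -> R)
    (q : Omega d -> R -> Zd d -> Zd d -> R)
    (Ohk : set (Omega d)) (Thk : Zd d -> Omega d -> \bar R) : Prop :=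
  measurable Ohk /\ P Ohk = 1%E /\
  (forall x, measurable_fun [set: Omega d] (Thk x)) /\
  exists c1 c2 c3 c4 c C : R,
    [/\ 0 < c1, 0 < c2, 0 < c3 & 0 < c4] /\ (0 < c /\ 0 < C) /\
    (forall w, Ohk w -> forall x, S_oo R w x ->
      (Thk x w < +oo)%E /\
      forall t : R, 0 < t -> (Thk x w <= t%:E)%E ->
      forall y, S_oo R w y ->
      forall F D,
        F = q w t x y \/
        F = p w (Num.truncn t) x y + p w (Num.truncn t).+1 x y ->
        D = graph_dist R (S_oo R w) x y \/ D = (dist1 x y)%:R%:E ->
        gaussian_bounds d c1 c2 c3 c4 t F D) /\
    (forall (z : Zd d) (r : R), 1 <= r ->
      (P [set w | (r%:E <= Thk z w)%E] <=
       (C * expR (- (c * ln r `^ (1 + Delta))))%:E)%E).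

(* Main.v *)
(** The holding times of [Y] have mean one and are independent of its jump chain,
so the Green function is the sum over [n] of the heat kernels [p_n(x, y)] of the
discrete walk, which is symmetric in [x] and [y]; hence one may assume that the
minimum is attained at [x].  Write [D] for the distance of [x] and [y].  The sum
of [D^2] terms of order [D^-d] with [D^2 <= n <= 2 D^2] gives the lower bound.
For the upper bound the terms [n < D] vanish, the Gaussian bound handles
[n >= Thk x], and for [D <= n < Thk x] the Carne-Varopoulos inequality
[p_n(x, y) <= 2 exp(- D^2 / (8 n))] suffices, because [Thk x] is at most
[D^2 / (1 + C3 log D)]. *)

Require Import Defs.
From mathcomp Require Import all_boot all_order all_algebra.
From mathcomp Require Import finmap.
From mathcomp Require Import all_classical all_reals all_analysis.
From mathcomp Require Import measurable_realfun.
From mathcomp Require Import ring lra zify.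

Set Implicit Arguments.
Unset Strict Implicit.
Unset Printing Implicit Defensive.

Import Order.TTheory GRing.Theory Num.Theory.
Local Open Scope classical_set_scope.
Local Open Scope ring_scope.

(** * Random walk kernels *)

(** Both walks are known only through the probabilities of finite trajectories, so no Markov
    property can be quoted: one-time laws come from summing path weights over one coordinate at a
    time. The Carne-Varopoulos inequality usually rests on spectral calculus for a self-adjoint
    operator on an infinite graph. Since n steps see only a finite ball, a finite symmetric matrix
    replaces the operator, and its Chebyshev polynomials are controlled by an algebraic form of
    cos^2 + sin^2 = 1 rather than by eigenvalues. The same matrix gives the symmetry of the heat
    kernel. In the upper bound each of the D^2 terms before time D^2 is of order D^-d. Beyond D^2
    the terms are of order n^(-d/2), and their sum is of order D^(2-d) because d is at least 3. *)

Lemma dist1_sym d (x y : Zd d) : dist1 x y = dist1 y x.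
Proof. by apply: eq_bigr => i _; rewrite distnC. Qed.

Lemma dist1xx d (x : Zd d) : dist1 x x = 0%N.
Proof. by rewrite /dist1 big1 // => i _; rewrite distnn. Qed.

Lemma dist1_eq0 d (x y : Zd d) : (dist1 x y == 0%N) = (x == y).
Proof.
apply/idP/eqP => [|->]; last by rewrite dist1xx.
rewrite sum_nat_eq0 => /forallP xy; apply/rowP => i.
by have := xy i; rewrite absz_eq0 subr_eq0 => /eqP.
Qed.

Lemma dist1_triangle d (y x z : Zd d) :
  (dist1 x z <= dist1 x y + dist1 y z)%N.
Proof. by rewrite -big_split leq_sum // => i _; exact: leqD_dist. Qed.

Lemma adj_sym d (x y : Zd d) : adj x y = adj y x.
Proof. by rewrite /adj dist1_sym. Qed.

Lemma finite_dist1_ball d (x : Zd d) n : finite_set [set y | (dist1 x y <= n)%N].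
Proof.
pose f (g : {ffun 'I_d -> 'I_(n + n).+1}) : Zd d :=
  \row_i (x ord0 i + ((g i)%:Z - n%:Z)).
apply: (@sub_finite_set _ _ (f @` [set` finset.setT])); last first.
  by apply: finite_image; exact: finite_finset.
move=> y /= xy.
have yi i : (`|(x ord0 i - y ord0 i)%R| <= n)%N.
  by apply: leq_trans xy; rewrite /dist1 (bigD1 i) //= leq_addr.
exists [ffun i => inord `|(y ord0 i - x ord0 i + n%:Z)%R|%N] => //.
apply/rowP => i; rewrite !mxE ffunE inordK; have := yi i;
  by set a := x ord0 i; set b := y _ i; lia.
Qed.

Definition nbrs d (x : Zd d) : {fset Zd d} := fset_set [set y | adj x y].

Lemma mem_nbrs d (x y : Zd d) : (y \in nbrs x) = adj x y.
Proof.
rewrite in_fset_set; last first.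
  by apply: (sub_finite_set _ (finite_dist1_ball x 1)) => z /eqP /= ->.
by apply/idP/idP; rewrite inE.
Qed.

Section walk_kernel.
Variables (R : realType) (d : nat) (G : set (Zd d)).

(** Transition probabilities as finite sums, free of any probability space, so that the discrete
    walk and the jump chain of the continuous one share one kernel. *)
Fixpoint walk_kernel n (x y : Zd d) : R :=
  if n is n'.+1 then \sum_(z <- nbrs x) step R G x z * walk_kernel n' z y
  else (x == y)%:R.

Lemma step_ge0 x y : 0 <= step R G x y.
Proof. by rewrite /step; case: ifP => // _; rewrite invr_ge0. Qed.

Lemma walk_kernelS n x y : walk_kernel n.+1 x y =
  \sum_(z <- nbrs x) step R G x z * walk_kernel n z y.
Proof. by []. Qed.

Lemma walk_kernel_ge0 n x y : 0 <= walk_kernel n x y.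
Proof.
elim: n x => //= n IHn x.
by apply: sumr_ge0 => z _; rewrite mulr_ge0 ?step_ge0.
Qed.

Lemma esum_step x (f : Zd d -> R) : (forall z, 0 <= f z) ->
  (\esum_(z in setT) (step R G x z * f z)%:E =
   (\sum_(z <- nbrs x) step R G x z * f z)%:E)%E.
Proof.
move=> f0; transitivity (\esum_(z in [set` nbrs x]) (step R G x z * f z)%:E)%E.
  rewrite [RHS]esum_mkcond; apply: eq_esum => z _; case: ifPn => // /negP zx.
  rewrite /step; case: ifP => [/andP[_ xz]|]; last by rewrite mul0r.
  by case: zx; rewrite inE /= mem_nbrs.
rewrite esum_fset //; last by move=> i _; rewrite lee_fin mulr_ge0 ?step_ge0.
by rewrite fsbig_finite //= set_fsetK sumEFin.
Qed.

Definition heat_kernel n x y : R := walk_kernel n x y / (degree G y)%:R.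

Lemma heat_kernel_ge0 n x y : 0 <= heat_kernel n x y.
Proof. by rewrite divr_ge0 ?walk_kernel_ge0. Qed.

End walk_kernel.

(** * One-time laws from cylinder probabilities *)

Section paths.
Variables (R : realType) (d : nat) (dT : measure_display).
Variables (T : measurableType dT) (Z : nat -> T -> Zd d).
Hypothesis mZ : forall n z, measurable (Z n @^-1` [set z]).
Implicit Types (s : nat -> Zd d) (mu : {measure set T -> \bar R}).

Definition cylinder n s : set T := [set t | forall k, (k < n)%N -> Z k t = s k].

Definition set_path s n z : nat -> Zd d := fun k => if (k < n)%N then s k else z.

Lemma measurable_cylinder n s : measurable (cylinder n s).
Proof.
rewrite (_ : cylinder n s = \bigcap_(k in [set k | (k < n)%N]) Z k @^-1` [set s k]).
  exact: bigcap_measurableType.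
by apply/seteqP; split.
Qed.

Lemma cylinderS n s z :
  cylinder n s `&` Z n @^-1` [set z] = cylinder n.+1 (set_path s n z).
Proof.
apply/seteqP; split => [t /= [ts zt] k|t /= ts].
  by rewrite /set_path ltnS leq_eqVlt => /predU1P[->|kn]; rewrite ?ltnn ?kn //;
    exact: ts.
split => [k kn|]; first by rewrite ts ?/set_path ?kn // ltnW.
by rewrite ts ?/set_path ?ltnn.
Qed.

(** Z^d is countable: numbering the cells by [choice.pickle (Z n t)] reduces the claim to countable
    additivity over the naturals, where numbers that code no point give empty cells. *)
Lemma measure_partition mu n (A : set T) : measurable A ->
  mu A = (\esum_(z in setT) mu (A `&` Z n @^-1` [set z]))%E.
Proof.
move=> mA; pose F i : set T := A `&` [set t | choice.pickle (Z n t) = i].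
have FE i : F i = if choice.unpickle i is Some z then
    if choice.pickle z == i then A `&` Z n @^-1` [set z] else set0 else set0.
  apply/seteqP; split => [t [At <-]|t]; first by rewrite choice.pickleK eqxx.
  by case: choice.unpickle => [z|//]; case: eqP => // <- [At zt]; split=> //;
    congr choice.pickle.
have mF i : measurable (F i).
  by rewrite FE; case: choice.unpickle => // z; case: ifP => // _; exact: measurableI.
have -> : mu A = (\sum_(i <oo) mu (F i))%E.
  rewrite -measure_semi_bigcup //.
  - by congr (mu _); apply/seteqP; split => [t At|t [i _] []//];
    exists (choice.pickle (Z n t)).
  - by move=> i j _ _ [t [[_ <-] [_ <-]]].
  - exact: bigcup_measurable.
rewrite nneseries_esumT //.
transitivity (\esum_(i in range (@choice.pickle (Zd d))) mu (F i))%E.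
  rewrite [RHS]esum_mkcond; apply: eq_esum => i _; case: ifPn => // /negP iz.
  rewrite (_ : F i = set0) ?measure0 // -subset0 => t [_ ti].
  by apply: iz; rewrite inE; exists (Z n t).
rewrite esum_image; last by move=> z z' _ _ /(pcan_inj choice.pickleK).
by apply: eq_esum => z _; rewrite FE choice.pickleK eqxx.
Qed.

Lemma eq_measure_cylinder mu1 mu2 n :
  (forall s, mu1 (cylinder n s) = mu2 (cylinder n s)) -> mu1 setT = mu2 setT.
Proof.
elim: n => [|n IHn] eqmu.
  have <- : cylinder 0 (fun=> 0) = setT by rewrite -subTset.
  exact: eqmu.
apply: IHn => s; rewrite !(measure_partition _ n (measurable_cylinder n s)).
by apply: eq_esum => z _; rewrite cylinderS.
Qed.

Definition path_weight (G : set (Zd d)) x n s : R :=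
  (s 0%N == x)%:R * \prod_(k < n) step R G (s k) (s k.+1).

Lemma path_weight_ge0 G x n s : 0 <= path_weight G x n s.
Proof. by rewrite mulr_ge0 ?prodr_ge0 // => k _; exact: step_ge0. Qed.

Lemma path_weight_set_path G x n s z :
  path_weight G x n.+1 (set_path s n.+1 z) =
  path_weight G x n s * step R G (s n) z.
Proof.
rewrite /path_weight big_ord_recr /= mulrA {1 4 5}/set_path /= ltnSn ltnn.
congr (_ * _ * _); apply: eq_bigr => k _.
by rewrite /set_path !ltnS (ltn_ord k) ltnW.
Qed.

(** The factor [c] allows [mu] to be a probability restricted to an event about a holding time. *)
Lemma walk_law mu (G : set (Zd d)) x n (c : R) : 0 <= c ->
  (forall s, mu (cylinder n.+1 s) = (c * path_weight G x n s)%:E) ->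
  forall y, mu (Z n @^-1` [set y]) = (c * walk_kernel R G n x y)%:E.
Proof.
move=> c0 muE y.
(* [m] counts the remaining steps: with the first n - m + 1 positions fixed, summing over the next
   position reproduces the recursion of [walk_kernel]. *)
have law m s : (m <= n)%N ->
    mu (cylinder (n - m).+1 s `&` Z n @^-1` [set y]) =
    (c * path_weight G x (n - m) s * walk_kernel R G m (s (n - m)%N) y)%:E.
  elim: m s => [|m IHm] s mn.
    rewrite subn0 /=; case: eqP => [<-|sy].
      rewrite mulr1 -muE; congr (mu _); apply/seteqP; split => [t []//|t ts].
      by split=> //=; rewrite ts.
    rewrite mulr0 (_ : _ `&` _ = set0) ?measure0 // -subset0 => t [ts /= ty].
    by apply: sy; rewrite -ty ts.
  have mnS : (n - m)%N = (n - m.+1).+1 by rewrite subnSK.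
  rewrite (measure_partition _ (n - m)); last first.
    by apply: measurableI => //; exact: measurable_cylinder.
  rewrite walk_kernelS mulr_sumr.
  under [in RHS]eq_bigr do rewrite mulrCA.
  rewrite -esum_step; last first.
    by move=> z; rewrite mulr_ge0 ?walk_kernel_ge0 ?[0 <= c * _]mulr_ge0 ?path_weight_ge0.
  congr (esum _ _); apply: boolp.funext => z;
    rewrite setIAC mnS cylinderS -mnS IHm 1?ltnW //.
  rewrite mnS path_weight_set_path /set_path ltnn; congr EFin; ring.
rewrite (measure_partition _ 0) //.
have := law n _ (leqnn n); rewrite subnn => law0.
rewrite (eq_esum (b := fun z => if z \in [set x] then
    (c * walk_kernel R G n x y)%:E else 0%E)); last first.
  move=> z _; have := law0 (fun=> z).
  rewrite (_ : cylinder 1 _ = Z 0%N @^-1` [set z]); last first.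
    by apply/seteqP; split => [t /(_ 0%N)|t tz [|]] //=; exact.
  rewrite setIC => ->; rewrite /path_weight big_ord0 mulr1.
  have [->|/eqP zx] := eqVneq z x; first by rewrite mem_set // mulr1.
  by rewrite memNset // mulr0 mul0r.
rewrite -esum_mkcond esum_set1 // lee_fin mulr_ge0 ?walk_kernel_ge0 //.
Qed.

End paths.

(** * The Green function as a sum of discrete heat kernels *)

Section layers.
Variables (R : realType) (dT : measure_display) (T : measurableType dT).
Variables (Q : probability T R) (A : set T) (f g : T -> R).
Hypotheses (mA : measurable A).
Hypotheses (mf : measurable_fun setT f) (mg : measurable_fun setT g).
Let GR := measurableTypeR R.
Let B : set (GR * T) := [set p | [/\ A p.2, f p.2 <= p.1 & p.1 < g p.2]].

Let mB : measurable B.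
Proof.
rewrite (_ : B = setT `*` A `&` ([set p | f p.2 <= p.1] `&` [set p | p.1 < g p.2])).
  have m1 : measurable_fun setT (fun p : GR * T => p.1) by exact: measurable_fst.
  have m2 (h : T -> R) : measurable_fun setT h ->
      measurable_fun setT (fun p : GR * T => h p.2).
    by move=> mh; apply: (measurableT_comp (f := h) (g := snd)) => //;
      exact: measurable_snd.
  apply: measurableI; first exact: measurableX.
  apply: measurableI.
    have := measurable_fun_ler (m2 _ mf) m1.
    by move=> /(_ measurableT [set true]); rewrite setTI; exact.
  have := measurable_fun_ltr m1 (m2 _ mg).
  by move=> /(_ measurableT [set true]); rewrite setTI; exact.
by apply/seteqP; split => [p [? ? ?]|p [[_ ?] [? ?]]].
Qed.

Let xsectionB s : xsection B s = A `&` [set t | f t <= s < g t].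
Proof.
apply/seteqP; split => t; rewrite /xsection /= inE => -[].
  by move=> At /= -> ->.
by move=> At /andP[].
Qed.

Lemma measurable_fun_layer : measurable_fun setT
  (fun s : measurableTypeR R => Q (A `&` [set t | f t <= s < g t])).
Proof.
rewrite (_ : (fun s => _) = Q \o xsection B); first exact: measurable_fun_xsection.
by apply/funext => s; rewrite /= xsectionB.
Qed.

(** Tonelli on the region between the graphs of [f] and [g]: each [t] in [A] contributes the length
    of its interval. *)
Lemma integral_layer : (forall t, A t -> 0 <= f t <= g t) ->
  (\int[lebesgue_measure]_(s in `[0%R, +oo[)
      Q (A `&` [set t | (f t <= s < g t)%R]) = \int[Q]_(t in A) (g t - f t)%:E)%E.
Proof.
move=> fg.
have mh : measurable_fun setT (fun p : GR * T => (\1_B p)%:E : \bar R).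
  exact/measurable_EFinP/measurable_indic.
transitivity (\int[lebesgue_measure]_s \int[Q]_t (\1_B (s, t))%:E)%E.
  rewrite integral_mkcond; apply: eq_integral => s _.
  rewrite (_ : (fun t => _) = (fun t => (\1_[set t | B (s, t)] t)%:E)) //.
  have BsE : [set t | B (s, t)] = A `&` [set t | f t <= s < g t].
    by rewrite -xsectionB; apply/seteqP; split => t; rewrite /xsection /= inE.
  have mBs : measurable [set t | B (s, t)].
    by rewrite BsE -xsectionB; exact: measurable_xsection.
  rewrite integral_indic // setIT BsE.
  rewrite patchE; case: ifPn => //; rewrite notin_setE /= in_itv /= andbT.
  move=> s0; rewrite (_ : _ `&` _ = set0) ?measure0 // -subset0.
  move=> t [/fg /andP[f0 _] /= /andP[fs _]]; apply: s0; exact: le_trans fs.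
rewrite (@fubini_tonelli _ _ _ _ R lebesgue_measure Q
  (fun p : GR * T => (\1_B p)%:E)) //.
rewrite [RHS]integral_mkcond; apply: eq_integral => t _.
rewrite patchE; case: ifPn => [/set_mem At|/negP tA]; last first.
  rewrite integral0_eq // => s _; rewrite indicE memNset // => -[/= ? _ _].
  by apply: tA; rewrite inE.
transitivity (\int[lebesgue_measure]_s (\1_`[f t, g t[ s)%:E)%E.
  apply: eq_integral => s _; rewrite !indicE; congr (_%:R%:E); congr nat_of_bool;
    apply/idP/idP; rewrite !inE /= in_itv /=.
    by move=> [_ /= -> ->].
  by move=> /andP[].
rewrite integral_indic // setIT; apply: (etrans (lebesgue_measure_itv _));
  rewrite /= lte_fin.
have /andP[_] := fg _ At; rewrite le_eqVlt => /orP[/eqP ->|->] //.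
by rewrite ltxx subrr.
Qed.

End layers.

Section exponential_law.
Variable R : realType.
Notation expd := (exponential_prob (1 : R)).

(** [exponential_prob] is a bare set function; packaging it as a probability measure, which uses
    that the rate 1 is positive, gives access to the general facts on measures. *)
Lemma exponential_probE :
  exists e : probability (measurableTypeR R) R, forall A, e A = expd A.
Proof.
by exists (exponential_distribution_exponential_prob__canonical__probability_measure_Probability (@ltr01 R)).
Qed.

Lemma exponential_prob_ge0 A : (0 <= expd A)%E.
Proof. by have [e <-] := exponential_probE. Qed.

Lemma exponential_prob_setT : expd setT = 1%E.
Proof. by have [e <-] := exponential_probE; exact: probability_setT. Qed.

Lemma exponential_prob_fin (A : set (measurableTypeR R)) :
  measurable A -> expd A \is a fin_num.
Proof. by have [e <-] := exponential_probE; exact: fin_num_measure. Qed.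

Lemma exponential_prob_lt0 : expd `]-oo, 0[ = 0%E.
Proof.
rewrite /exponential_prob integral0_eq // => s /=; rewrite in_itv /= => s0.
by rewrite lt0_exponential_pdf.
Qed.

(** At rate one the tail e^(-s) coincides with the density, so its integral over s, the mean holding
    time, is 1. *)
Lemma exponential_prob_tail s : 0 <= s ->
  expd `]s, +oo[ = (exponential_pdf 1 s)%:E.
Proof.
move=> s0; rewrite exponential_pdfE // mul1r.
have e0 := exponential_prob_lt0.
have e0s : expd `[0, s] = (1 - (expR (-1 * s))%:E)%E.
  have [->|s1] := eqVneq s 0; last by rewrite exponential_prob_itv0c // lt0r s1.
  by rewrite set_itv1 /exponential_prob integral_set1 mulr0 expR0 subee.
have [e eE] := exponential_probE; rewrite -!eE in e0 e0s *.
rewrite (_ : `]s, +oo[%classic = ~` (`]-oo, 0[ `|` `[0, s])); last first.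
  apply/seteqP; split => r /=; rewrite !in_itv /= ?andbT.
    by move=> sr [|/andP[_]]; lra.
  by move=> rs; rewrite ltNge; apply/negP => rs'; apply: rs; case: (ltP r 0);
    [left|right].
rewrite probability_setC; last exact: measurableU.
have -> : e (`]-oo, 0[ `|` `[0, s]) = (1 - (expR (-1 * s))%:E)%E.
  rewrite -e0s -[RHS]add0e -e0; apply: measureU => //.
  apply/seteqP; split => r //=; rewrite !in_itv /= => -[r0 /andP[]].
  by rewrite leNgt r0.
transitivity ((1 - (1 - expR (- (1) * s)))%:E : \bar R) => //; congr EFin; ring.
Qed.
End exponential_law.

(** * Jump chain and holding times *)

Section jump_chain.
Variables (R : realType) (d : nat) (dT : measure_display).
Variables (T : measurableType dT) (G : set (Zd d)) (x : Zd d).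
Variables (Q : probability T R) (Z : nat -> T -> Zd d) (E : nat -> T -> R).
Hypothesis mZ : forall n z, measurable (Z n @^-1` [set z]).
Hypothesis mE : forall n, measurable_fun setT (E n).
Notation expd := (exponential_prob (1 : R)).
Hypothesis lawZE : forall n (s : nat -> Zd d) (B : nat -> set R),
  (forall k, measurable (B k)) ->
  (Q [set t | forall k, (k <= n)%N -> Z k t = s k /\ B k (E k t)] =
   (path_weight R G x n s)%:E * \prod_(k < n.+1) expd (B k))%E.

Let measurable_holding n (B : set R) : measurable B -> measurable (E n @^-1` B).
Proof. by move=> mB; rewrite -[X in measurable X]setTI; exact: mE. Qed.

Lemma measurable_holdings n (B : nat -> set R) : (forall k, measurable (B k)) ->
  measurable [set t | forall k, (k <= n)%N -> B k (E k t)].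
Proof.
move=> mB; rewrite (_ : [set t | _] =
    \bigcap_(k in [set k | (k <= n)%N]) (E k @^-1` B k)).
  by apply: bigcap_measurableType => k _; exact: measurable_holding.
by apply/seteqP; split.
Qed.

(** [Q] restricted to the event on [E n] gives each cylinder its path weight times [expd B], so
    [walk_law] applies to it. *)
Lemma jump_law n y (B : set R) : measurable B ->
  Q (Z n @^-1` [set y] `&` E n @^-1` B) =
  ((walk_kernel R G n x y)%:E * expd B)%E.
Proof.
move=> mB; have mEB := measurable_holding n mB.
have finB : expd B \is a fin_num by exact: exponential_prob_fin.
pose nu : {measure set T -> \bar R} := mrestr Q mEB.
have c0 : 0 <= fine (expd B) by rewrite fine_ge0 // exponential_prob_ge0.
have cE : (fine (expd B))%:E = expd B by exact: fineK.
rewrite -cE muleC; apply: (walk_law (mu := nu) mZ c0) => s.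
transitivity (expd B * (path_weight R G x n s)%:E)%E; last by rewrite -cE.
rewrite /nu /= /mrestr.
pose B' k : set R := if (k < n)%N then setT else B.
have mB' k : measurable (B' k) by rewrite /B'; case: ifP.
have := lawZE n s mB'; rewrite [RHS]muleC big_ord_recr /=.
rewrite big1 ?mul1e => [|k _]; last by rewrite /B' ltn_ord exponential_prob_setT.
rewrite /B' ltnn => <-; congr (Q _); apply/seteqP; split => [t [ts tB] k kn|t ts].
  split; first exact: ts.
  by case: ltnP => // nk; rewrite (_ : k = n) //; apply/eqP; rewrite eqn_leq kn nk.
split => [k kn|]; first by have [] := ts k kn.
by have [_] := ts n (leqnn n); rewrite ltnn.
Qed.

(** The joint law prescribes the positions as well. They are summed out by comparing two measures
    that agree on cylinders of [Z]: [Q] restricted to the event, and [Q] scaled by the product. *)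
Lemma holding_law n (B : nat -> set R) : (forall k, measurable (B k)) ->
  (Q [set t | forall k, (k <= n)%N -> B k (E k t)] =
   \prod_(k < n.+1) expd (B k))%E.
Proof.
move=> mB; have mC := measurable_holdings n mB.
set C := [set t | _] in mC *.
have fin_prod : (\prod_(k < n.+1) expd (B k))%E \is a fin_num.
  apply: (big_ind (fun r : \bar R => r \is a fin_num)) => // [r s|k _].
    exact: fin_numM.
  by apply: exponential_prob_fin; exact: mB.
have prod0 : 0 <= fine (\prod_(k < n.+1) expd (B k))%E.
  by rewrite fine_ge0 // prode_ge0 // => k _; exact: exponential_prob_ge0.
pose nu1 : {measure set T -> \bar R} := mrestr Q mC.
pose nu2 : {measure set T -> \bar R} := mscale (NngNum prod0) Q.
transitivity (nu1 setT); first by rewrite /nu1 /= /mrestr setTI.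
transitivity (nu2 setT); last first.
  by rewrite /nu2 /= /mscale /= probability_setT mule1; exact: fineK.
apply: (eq_measure_cylinder mZ (n := n.+1)) => s.
rewrite /nu1 /nu2 /= /mrestr /mscale /=; transitivity
  (\prod_(k < n.+1) expd (B k) * Q (cylinder Z n.+1 s))%E; last first.
  by congr (_ * _)%E; exact/esym/fineK.
have := lawZE n s mB.
have := lawZE n s (fun=> measurableT); rewrite [X in (_ * X)%E]big1; last first.
  by move=> k _; exact: exponential_prob_setT.
rewrite mule1 => cylE; rewrite (_ : [set t | _] = cylinder Z n.+1 s) in cylE;
  last first.
  by apply/seteqP; split => t ts k kn; [have [] := ts k kn | split => //; exact: ts].
rewrite muleC => joint; rewrite cylE -joint; congr (Q _).
apply/seteqP; split => [t [ts tB] k kn|t ts]; first by split; [exact: ts|exact: tB].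
by split => k kn; have [] := ts k kn.
Qed.

Lemma holding_ge0 n : Q (E n @^-1` `]-oo, 0[) = 0%E.
Proof.
pose B k : set R := if k == n then `]-oo, 0[%classic else setT.
have mB k : measurable (B k) by rewrite /B; case: ifP.
apply/eqP; rewrite -measure_le0.
have <- : Q [set t | forall k, (k <= n)%N -> B k (E k t)] = 0%E.
  rewrite holding_law // big_ord_recr /= /B eqxx.
  by rewrite exponential_prob_lt0 mule0.
apply: le_measure; rewrite ?inE;
  [exact: measurable_holding|exact: measurable_holdings|].
by move=> t tn k _; rewrite /B; case: eqP => // ->.
Qed.

(** The probability that n + 1 successive holding times lie in [[0, 1]] decays geometrically. Hence
    almost surely infinitely many exceed 1, which makes the arrival times diverge and excludes
    explosion. *)
Lemma holding_gt1_io m :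
  Q [set t | forall k, (m <= k)%N -> (E k @^-1` `[0, 1]) t] = 0%E.
Proof.
set A := [set t | _].
have mA : measurable A.
  rewrite (_ : A = \bigcap_(k in [set k | (m <= k)%N]) (E k @^-1` `[0, 1])).
    by apply: bigcap_measurableType => k _; exact: measurable_holding.
  by apply/seteqP; split.
pose r : R := 1 - expR (- 1).
have r01 : 0 <= r < 1.
  by rewrite /r subr_ge0 gtrBl expR_gt0 andbT -[leRHS]expR0 ler_expR; lra.
have Ar n : (Q A <= (r ^+ n.+1)%:E)%E.
  pose B k : set R := if (k < m)%N then setT else `[0, 1]%classic.
  have mB k : measurable (B k) by rewrite /B; case: ifP.
  apply: (@le_trans _ _ (Q [set t | forall k, (k <= m + n)%N -> B k (E k t)])).
    apply: le_measure; rewrite ?inE //; first exact: measurable_holdings.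
    by move=> t tA k _; rewrite /B; case: ltnP => // /tA.
  rewrite holding_law // -addnS big_split_ord /= big1 ?mul1e => [|k _]; last first.
    by rewrite /B ltn_ord exponential_prob_setT.
  rewrite (eq_bigr (fun=> r%:E)) => [|k _]; last first.
    by rewrite /B ltnNge leq_addr /= exponential_prob_itv0c // mulr1.
  by rewrite prodEFin prodr_const card_ord.
have cvgr : (r ^+ n.+1)%:E @[n --> \oo] --> 0%E.
  apply: cvg_EFin; first exact: nearW.
  have : r ^+ n @[n --> \oo] --> 0.
    by apply: cvg_expr; case/andP: r01 => r0 r1; rewrite ger0_norm.
  by rewrite -(@cvg_shiftS R^o _ (nbhs 0)).
apply/eqP; rewrite -measure_le0; apply: (cvge_ge _ cvgr).
by apply: nearW => n /=; exact: Ar.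
Qed.
End jump_chain.

Section arrival_times.
Variables (R : realType) (e : nat -> R).
Hypothesis e_ge0 : forall k, 0 <= e k.
Hypothesis e_io : forall m, exists2 k, (m <= k)%N & ~ (0 <= e k <= 1).
Let S n := \sum_(k < n) e k.

Lemma arrival_time_nd : {homo S : m n / (m <= n)%N >-> m <= n}.
Proof.
apply: homo_leq => // [|n]; first exact: le_trans.
by rewrite /S big_ord_recr /= lerDl.
Qed.

Lemma arrival_time_unbounded m : exists n, m%:R <= S n.
Proof.
elim: m => [|m [n mn]]; first by exists 0%N; rewrite /S big_ord0.
have [k nk ek] := e_io n; exists k.+1.
rewrite /S big_ord_recr /= -natr1 lerD //.
  exact: le_trans mn (arrival_time_nd nk).
by have := e_ge0 k; case: (leP 1 (e k)) => // /ltW e1 e0; case: ek; rewrite e0.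
Qed.

Lemma arrival_time_exists s : 0 <= s -> exists n, S n <= s < S n.+1.
Proof.
move=> s0; have ex : exists n, s < S n.
  have [n] := arrival_time_unbounded (Num.truncn s).+1.
  by exists n; apply: lt_le_trans p; exact: truncnS_gt.
have : s < S (ex_minn ex) by case: ex_minnP.
case: ex_minnP => -[|n] // sn nmin _; first by move: sn; rewrite /S big_ord0 ltNge s0.
exists n; rewrite sn andbT leNgt; apply/negP => /nmin.
by rewrite ltnn.
Qed.

Lemma arrival_time_uniq s m n :
  S m <= s < S m.+1 -> S n <= s < S n.+1 -> m = n.
Proof.
wlog mn : m n / (m <= n)%N.
  move=> wl Sm Sn; case: (leqP m n) => [mn|/ltnW mn]; first exact: wl.
  by apply/esym; exact: wl.
move=> /andP[_ sm] /andP[ns _]; apply/eqP; rewrite eqn_leq mn leqNgt /=.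
by apply/negP => /arrival_time_nd Smn; have := lt_le_trans sm (le_trans Smn ns);
  rewrite ltxx.
Qed.

End arrival_times.

Lemma probability_setI (R : realType) dT (T : measurableType dT)
    (Q : probability T R) (A N : set T) :
  measurable A -> measurable N -> Q N = 0%E -> Q A = Q (A `&` ~` N).
Proof.
move=> mA mN N0; have mAN : measurable (A `&` N) by exact: measurableI.
have mAN' : measurable (A `&` ~` N) by apply: measurableI => //; exact: measurableC.
have AN0 : Q (A `&` N) = 0%E.
  by apply/eqP; rewrite -measure_le0 -N0; apply: le_measure; rewrite ?inE.
by rewrite -(measureU0 mAN' mAN AN0) -setIUr setvU setIT.
Qed.

Lemma green_series (R : realType) d dT (T : measurableType dT) (G : set (Zd d))
    (Q : Zd d -> probability T R) (Y : R -> T -> Zd d) x y :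
  is_ctsrw G x (Q x) Y ->
  (green G Q Y x y =
   \sum_(n <oo) (heat_kernel R G n x y)%:E)%E.
Proof.
move=> [mY [Z [E [mZ mE lawZE [N0 [mN0 QN0 YN0]]]]]].
pose S n t := \sum_(k < n) E k t.
have mS n : measurable_fun setT (S n) by exact: measurable_sum.
(* [N1] and [N2] are the events that some holding time is negative, and that the
   walk may explode. *)
pose N1 := \bigcup_k (E k @^-1` `]-oo, 0[).
pose N2 := \bigcup_m [set t | forall k, (m <= k)%N -> (E k @^-1` `[0, 1]) t].
have mEB n (B : set R) : measurable B -> measurable (E n @^-1` B).
  by move=> mB; rewrite -[X in measurable X]setTI; exact: mE.
have mN2m m : measurable [set t | forall k, (m <= k)%N -> (E k @^-1` `[0, 1]) t].
  rewrite (_ : [set t | _] = \bigcap_(k in [set k | (m <= k)%N]) (E k @^-1` `[0, 1])).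
    by apply: bigcap_measurableType => k _; exact: mEB.
  by apply/seteqP; split.
have N1_0 : (Q x).-negligible N1.
  apply: negligible_bigcup => k; apply/negligibleP; first exact: mEB.
  exact: holding_ge0 lawZE k.
have N2_0 : (Q x).-negligible N2.
  apply: negligible_bigcup => k; apply/negligibleP => //.
  exact: holding_gt1_io lawZE k.
have mN1 : measurable N1 by apply: bigcup_measurable => k _; exact: mEB.
have mN2 : measurable N2 by apply: bigcup_measurable => k _; exact: mN2m.
pose N := N0 `|` N1 `|` N2.
have mN : measurable N by apply: measurableU => //; exact: measurableU.
have QN : Q x N = 0%E.
  apply: measure_negligible => //; apply: negligibleU => //; apply: negligibleU => //.
  exact/negligibleP.
have E0 t k : (~` N) t -> 0 <= E k t.
  move=> Nt; rewrite leNgt; apply/negP => Et; apply: Nt; left; right.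
  by exists k => //=; rewrite in_itv /= Et.
have Eio t m : (~` N) t -> exists2 k, (m <= k)%N & ~ (0 <= E k t <= 1).
  move=> Nt; apply: contrapT => noE; apply: Nt; right; exists m => // k mk /=.
  by rewrite in_itv /=; apply: contrapT => Ek; apply: noE; exists k.
have YE t s n : (~` N) t -> 0 <= s -> S n t <= s < S n.+1 t -> Y s t = Z n t.
  move=> Nt s0 /andP[Sn Sn1]; move: s n s0 Sn Sn1.
  by apply: contrapT => YN; apply: Nt; left; left; apply: YN0.
pose A n := Z n @^-1` [set y] `&` ~` N.
have mA n : measurable (A n) by apply: measurableI => //; exact: measurableC.
have mfin s : measurable_fun setT (cst s : T -> R) by exact: measurable_cst.
pose F n (s : R) := Q x (A n `&` [set t | S n t <= s < S n.+1 t]).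
have mF n s : measurable [set t | S n t <= s < S n.+1 t].
  rewrite (_ : [set t | _] = [set t | S n t <= s] `&` [set t | s < S n.+1 t]);
    last first.
    by apply/seteqP; split => t /andP.
  apply: measurableI.
    have := measurable_fun_ler (mS n) (mfin s).
    by move=> /(_ measurableT [set true]); rewrite setTI; exact.
  have := measurable_fun_ltr (mfin s) (mS n.+1).
  by move=> /(_ measurableT [set true]); rewrite setTI; exact.
(* Outside [N] exactly one [n], the number of jumps made by time [s], satisfies
   [S n t <= s < S n.+1 t]. *)
have QY s : 0 <= s -> Q x (Y s @^-1` [set y]) = (\sum_(n <oo) F n s)%E.
  move=> s0; rewrite (@probability_setI _ _ _ (Q x) _ N) //; last exact: mY.
  rewrite -measure_semi_bigcup.
  - congr (Q x _); apply/seteqP; split => t.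
      move=> [/= Yt Nt]; have [n Sn] := arrival_time_exists (E0 t ^~ Nt) (Eio t ^~ Nt) s0.
      by exists n => //; split=> //; split=> //=; rewrite -(YE t s n).
    by move=> [n _ [[/= Zt Nt] Sn]]; split=> //=; rewrite (YE t s n).
  - by move=> n; apply: measurableI.
  - move=> m n _ _ [t [[[_ Nt] Sm] [_ Sn]]].
    exact: (@arrival_time_uniq _ (fun k => E k t) (E0 t ^~ Nt) s m n Sm Sn).
  - by apply: bigcup_measurable => n _; exact: measurableI.
have intF n : (\int[lebesgue_measure]_(s in `[0%R, +oo[) F n s =
    (walk_kernel R G n x y)%:E)%E.
  have S_ge0 m t : A n t -> 0 <= S m t.
    by move=> [_ Nt]; apply: sumr_ge0 => k _; exact: E0.
  have SS t : S n.+1 t = S n t + E n t by rewrite /S big_ord_recr.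
  rewrite integral_layer //; last first.
    by move=> t At; rewrite S_ge0 //= SS lerDl; apply: E0; case: At.
  (* The interval has length [E n] wherever it starts. Applying [integral_layer] backwards with left
     end 0 therefore removes [S n], and only the joint law of [Z n] and [E n] remains to be
     known. *)
  under eq_integral do rewrite SS addrAC subrr add0r -[E n _]subr0.
  rewrite -(@integral_layer _ _ _ (Q x) (A n) (cst 0) (E n)) //; last first.
    by move=> t [_ Nt]; rewrite lexx E0.
  transitivity (\int[lebesgue_measure]_(s in `[0%R, +oo[)
      ((walk_kernel R G n x y)%:E * (exponential_pdf 1 s)%:E))%E.
    apply: eq_integral => s; rewrite inE /= in_itv /= andbT => s0.
    rewrite -exponential_prob_tail // -(jump_law mZ mE lawZE) //.
    rewrite [RHS](@probability_setI _ _ _ (Q x) _ N) //; last first.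
      by apply: measurableI => //; exact: mEB.
    congr (Q x _); apply/seteqP; split => t; rewrite /= in_itv /= andbT s0.
      by move=> [[/= Zt Nt]].
    by move=> [[/= Zt Et] Nt].
  rewrite ge0_integralZl //; last 3 first.
  - apply/measurable_EFinP/measurable_funTS; exact: measurable_exponential_pdf.
  - by move=> s _; rewrite lee_fin exponential_pdf_ge0.
  - by rewrite lee_fin walk_kernel_ge0.
  rewrite -[RHS]mule1; congr (_ * _)%E.
  rewrite -(@integral_exponential_pdf R 1) // [LHS]integral_mkcond.
  apply: eq_integral => s _; rewrite patchE; case: ifPn => //.
  rewrite notin_setE /= in_itv /= andbT => /negP; rewrite -ltNge => s0.
  by rewrite lt0_exponential_pdf.
have mFs n : measurable_fun setT (F n : measurableTypeR R -> \bar R).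
  exact: measurable_fun_layer.
rewrite /green; transitivity (\int[lebesgue_measure]_(s in `[0%R, +oo[)
    (\sum_(n <oo) ((degree G y)%:R^-1%:E * F n s)))%E.
  apply: eq_integral => s; rewrite inE /= in_itv /= andbT => s0.
  rewrite nneseriesZl // -QY // /q_kernel EFinM muleC fineK //.
  by apply: fin_num_measure; exact: mY.
rewrite integral_nneseries //; last 2 first.
- by move=> n; apply: measurable_funeM; exact: measurable_funTS.
- by move=> n s _; rewrite mule_ge0.
apply: eq_eseriesr => n _; rewrite ge0_integralZl //.
  by rewrite intF -EFinM mulrC.
exact: measurable_funTS.
Qed.

(** * The Carne-Varopoulos inequality *)

Section chebyshev.
Variable R : realType.

(** The addition formulas of cosine and sine with X = cos t: the pair holds the Chebyshev
    polynomials T_k of the first kind and U_(k-1) of the second, with U_(-1) = 0. *)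
Fixpoint cheb (k : nat) : {poly R} * {poly R} :=
  if k is k'.+1 then
    let: (t, u) := cheb k' in ('X * t - (1 - 'X ^+ 2) * u, 'X * u + t)
  else (1, 0).

Definition chebT k := (cheb k).1.
Definition chebU k := (cheb k).2.

Lemma chebTS k : chebT k.+1 = 'X * chebT k - (1 - 'X ^+ 2) * chebU k.
Proof. by rewrite /chebT /chebU /=; case: (cheb k). Qed.

Lemma chebUS k : chebU k.+1 = 'X * chebU k + chebT k.
Proof. by rewrite /chebT /chebU /=; case: (cheb k). Qed.

Lemma cheb_pell k : chebT k ^+ 2 + (1 - 'X ^+ 2) * chebU k ^+ 2 = 1.
Proof.
elim: k => [|k IHk]; first by rewrite /chebT /chebU /= expr1n expr0n mulr0 addr0.
by rewrite chebTS chebUS -[RHS]IHk; ring.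
Qed.

Lemma chebT_rec k : 'X * chebT k.+1 *+ 2 = chebT k.+2 + chebT k.
Proof. by rewrite !(chebTS, chebUS); ring. Qed.

(** Only powers up to k enter T_k(A), which is why its entries between points further apart than k
    vanish. *)
Lemma size_chebT k : (size (chebT k) <= k.+1)%N.
Proof.
suff: (size (chebT k) <= k.+1)%N && (size (chebU k) <= k)%N by case/andP.
elim: k => [|k /andP[IHt IHu]]; first by rewrite size_poly1 size_poly0.
rewrite chebTS chebUS; apply/andP; split; apply: (leq_trans (size_polyD _ _));
  rewrite geq_max ?size_polyN; apply/andP; split.
- by apply: (leq_trans (size_polyMleq _ _)); rewrite size_polyX.
- apply: (leq_trans (size_polyMleq _ _)).
  have s3 : (size (1 - 'X ^+ 2 : {poly R})%R <= 3)%N.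
    apply: (leq_trans (size_polyD _ _)).
    by rewrite geq_max size_polyN size_polyXn size_poly1.
  by rewrite -subn1 leq_subLR; apply: leq_trans (leq_add s3 IHu) _; rewrite !addnS.
- by apply: (leq_trans (size_polyMleq _ _)); rewrite size_polyX.
- exact: IHt.
Qed.

End chebyshev.

(** * Polynomials of a symmetric contraction *)

Section contraction.
Variables (R : realType) (N : nat) (A : 'M[R]_N.+1).
Hypothesis A_sym : A^T = A.
Hypothesis A_le1 : forall v : 'cV[R]_N.+1,
  `|(v^T *m A *m v) 0 0| <= (v^T *m v) 0 0.

Lemma horner_mx_sum (p : {poly R}) :
  horner_mx A p = \sum_(i < size p) p`_i *: A ^+ i.
Proof.
rewrite -{1}[p]coefK poly_def rmorph_sum; apply: eq_bigr => i _.
by rewrite -mul_polyC rmorphM rmorphXn /= horner_mx_C horner_mx_X -mulmxE mul_scalar_mx.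
Qed.

Lemma horner_mx_tr (p : {poly R}) : (horner_mx A p)^T = horner_mx A p.
Proof.
elim/poly_ind: p => [|p c IHp]; first by rewrite rmorph0 trmx0.
rewrite rmorphD rmorphM /= horner_mx_X horner_mx_C linearD /= tr_scalar_mx.
by rewrite -mulmxE trmx_mul A_sym IHp; congr (_ + _); exact: comm_mx_horner.
Qed.

(* The Pell identity [T^2 + (1 - X^2) U^2 = 1], evaluated at [A], bounds the rows
   of [T(A)] by 1, because [2 (1 - X^2) = (1 + X) (1 - X)^2 + (1 - X) (1 + X)^2]
   is nonnegative at [A]. *)
Lemma chebT_entry_le1 k i j : `|horner_mx A (chebT R k) i j| <= 1.
Proof.
pose H := horner_mx A; pose form (B : 'M[R]_N.+1) (v : 'cV[R]_N.+1) := (v^T *m B *m v) 0 0 : R.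
have sqr p q : H (q * p ^+ 2) i i = form (H q) (col i (H p)).
  rewrite /H mulrC expr2 mulrAC !rmorphM /= -!mulmxE.
  rewrite -{1}[horner_mx A p]horner_mx_tr /form tr_col -!row_mul.
  rewrite !mxE; apply: eq_bigr => l _; rewrite !mxE.
  by congr (_ * _); apply: eq_bigr.
have form1 v : form 1 v = \sum_l v l 0 ^+ 2.
  by rewrite /form mulmx1 mxE; apply: eq_bigr => l _; rewrite mxE expr2.
have formA v : `|form A v| <= form 1 v by rewrite {2}/form mulmx1; exact: A_le1.
have formD B C v : form (B + C) v = form B v + form C v.
  by rewrite /form mulmxDr mulmxDl mxE.
have formN B v : form (- B) v = - form B v by rewrite /form mulmxN mulNmx mxE.
pose T := chebT R k; pose U := chebU R k.
have pell : (1 * T ^+ 2 + 1 * T ^+ 2) + ((1 + 'X) * ((1 - 'X) * U) ^+ 2 +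
    (1 - 'X) * ((1 + 'X) * U) ^+ 2) = 1 + 1.
  by transitivity ((T ^+ 2 + (1 - 'X ^+ 2) * U ^+ 2) *+ 2); [ring|rewrite cheb_pell].
have HD p q : H (p + q) i i = H p i i + H q i i by rewrite /H rmorphD mxE.
have H1 : H 1 = 1 by rewrite /H rmorph1.
have := congr1 (fun p => H p i i) pell.
rewrite !HD !sqr /H rmorphB !rmorphD /= -/H H1 [H 'X]horner_mx_X.
rewrite !formD formN form1 !mxE eqxx /=.
set v1 := col i (H ((1 - 'X) * U)); set v2 := col i (H ((1 + 'X) * U)).
set s := \sum_l _ => psum.
have s1 : s <= 1.
  have := formA v1; have := formA v2; rewrite !ler_norml => /andP[? ?] /andP[? ?]; lra.
suff : (H T i j) ^+ 2 <= 1 by rewrite -real_normK ?num_real // expr_le1.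
apply: le_trans s1.
rewrite /s (bigD1 j) //= mxE /H -[horner_mx A T in leLHS]horner_mx_tr mxE lerDl.
by apply: sumr_ge0 => l _; exact: sqr_ge0.
Qed.

(* Since [A T_k(A)] is the mean of [T_{k+1}(A)] and [T_{k-1}(A)], the entries of
   [A^n T_k(A)] are bounded, by induction on [n], by
   [e^(- l D) cosh(l)^n (2 cosh(l k))]; for [n = 0] they are at most 1, and
   vanish when [k < D]. *)
Lemma carne_varopoulos (D : nat) i j (l : R) n : 
  (forall k, (k < D)%N -> (A ^+ k) i j = 0) -> 0 <= l ->
  `|(A ^+ n) i j| <=
    2 * expR (- (l * D%:R)) * ((expR l + expR (- l)) / 2) ^+ n.
Proof.
move=> farD l0.
pose C x := (expR (l * x) + expR (- (l * x))).
pose H := horner_mx A.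
have C0 : C 0 = 2 by rewrite /C mulr0 oppr0 expR0.
have C_gt0 x : 0 < C x by rewrite addr_gt0 ?expR_gt0.
have CC x : C (x + 1) + C (x - 1) = C 1 * C x.
  by rewrite /C !mulrDr !mulrN !opprD !expRD opprK mulr1; ring.
have bound k : `|H ('X ^+ n * chebT R k) i j| <=
    expR (- (l * D%:R)) * (C 1 / 2) ^+ n * C k%:R.
  elim: n k => [|m IHm] k.
    rewrite expr0 mul1r mulr1; have [kD|Dk] := ltnP k D.
      rewrite /H horner_mx_sum summxE big1 ?normr0 => [|m _].
        by rewrite mulr_ge0 ?expR_ge0 // ltW.
      rewrite mxE farD ?mulr0 //; apply: leq_trans kD.
      exact: leq_trans (ltn_ord m) (size_chebT R k).
    (* For k at least D the bound exceeds 1, as it contains the term e^(l (k - D)). *)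
    apply: (le_trans (chebT_entry_le1 _ _ _)).
    rewrite /C mulrDr -!expRD -[leLHS]addr0 lerD ?expR_ge0 // -[leLHS]expR0 ler_expR.
    by rewrite addrC subr_ge0 ler_wpM2l // ler_nat.
  (* The recurrence at k = 0 would involve T_(-1); there X T_0 = T_1 is used directly, and [C 0 = 2]
     absorbs the factor 1/2. *)
  case: k => [|k].
    have -> : 'X ^+ m.+1 * chebT R 0 = 'X ^+ m * chebT R 1.
      by rewrite chebTS /chebT /chebU /= mulr0 subr0 exprSr mulrA.
    apply: le_trans (IHm 1%N) _; rewrite exprS.
    by rewrite le_eqVlt; apply/orP; left; apply/eqP; rewrite C0; field.
  have -> : 'X ^+ m.+1 * chebT R k.+1 =
      2^-1 *: ('X ^+ m * chebT R k.+2 + 'X ^+ m * chebT R k).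
    rewrite -mulrDr -chebT_rec exprSr mulrnAr.
    by rewrite -(@scalerMnr R) (@scalerMnl R) -[_ *+ 2]mulr_natr mulVf ?pnatr_eq0 // scale1r mulrA.
  rewrite /H linearZ /= mxE rmorphD mxE normrM ger0_norm ?invr_ge0 //.
  apply: (le_trans (ler_wpM2l _ (ler_normD _ _))); first by rewrite invr_ge0.
  apply: (le_trans (ler_wpM2l _ (lerD (IHm _) (IHm _)))); first by rewrite invr_ge0.
  have := CC k.+1%:R; rewrite -[k.+1%:R - 1](_ : k%:R = _); last first.
    by rewrite -natr1 addrK.
  rewrite natr1 => Ck.
  by rewrite -mulrDr Ck exprS le_eqVlt; apply/orP; left; apply/eqP; field.
have := bound 0%N; rewrite C0 /H /chebT /= mulr1 rmorphXn /= horner_mx_X.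
by rewrite {1}/C mulr1; congr (_ <= _); ring.
Qed.
End contraction.

(** Averaging e^h <= 1 + h + 2 h^2 over h = l and h = - l cancels the linear term. The constant 2 is
    not sharp, but any constant would do. *)
Lemma cosh_le (R : realType) (l : R) : 0 <= l <= 1 / 4 ->
  (expR l + expR (- l)) / 2 <= expR (2 * l ^+ 2).
Proof.
move=> /andP[l0 l1].
have exp_le (h : R) : `|h| <= 1 / 2 -> expR h <= 1 + h + 2 * h ^+ 2.
  rewrite ler_norml => /andP[h1 h2].
  have h0 : 0 < 1 - h by lra.
  have := expR_ge1Dx (- h); rewrite expRN => /le_trans.
  have : expR h <= (1 - h)^-1.
    by rewrite -[leLHS]invrK -expRN lef_pV2 ?posrE ?expR_gt0 //; exact: expR_ge1Dx.
  move=> + _; move=> /le_trans; apply.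
  rewrite -[leLHS]mul1r ler_pdivrMr //.
  have : 0 <= h ^+ 2 * (1 - 2 * h) by rewrite mulr_ge0 ?sqr_ge0 //; lra.
  have -> : (1 + h + 2 * h ^+ 2) * (1 - h) = 1 + h ^+ 2 * (1 - 2 * h) by ring.
  by lra.
have := exp_le l; have := exp_le (- l); rewrite normrN sqrrN ger0_norm //.
have := expR_ge1Dx (2 * l ^+ 2).
move=> h /(_ ltac:(lra)) h1 /(_ ltac:(lra)) h2; lra.
Qed.

(** * The killed walk as a symmetric matrix *)

Section killed_walk.
Variables (R : realType) (d : nat) (G : set (Zd d)) (N : nat) (s : seq (Zd d)).
Hypotheses (s_uniq : uniq s) (s_size : size s = N.+1).
Let pt (i : 'I_N.+1) : Zd d := nth 0 s i.
Let edge (x y : Zd d) : bool := `[< G x /\ G y >] && adj x y.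
Let r (x : Zd d) : R := (Num.sqrt (degree G x)%:R)^-1.

(* The kernel of the walk killed outside [s], conjugated by the square root of the
   degree to make it symmetric. An isolated vertex has [r x = 0], as [0^-1 = 0]. *)
Definition killed_mx : 'M[R]_N.+1 :=
  \matrix_(i, j) if edge (pt i) (pt j) then r (pt i) * r (pt j) else 0.
Local Notation A := killed_mx.

Let sum_pt (f : Zd d -> R) : \sum_i f (pt i) = \sum_(z <- s) f z.
Proof. by rewrite [RHS](big_nth 0) s_size big_mkord. Qed.

Let edge_sym x y : edge x y = edge y x.
Proof. by rewrite /edge adj_sym; congr (_ && _); apply/asboolP/asboolP => -[]. Qed.

Let r_ge0 x : 0 <= r x. Proof. by rewrite invr_ge0 sqrtr_ge0. Qed.

Let r_sqr x : r x ^+ 2 = (degree G x)%:R^-1.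
Proof. by rewrite exprVn sqr_sqrtr. Qed.

Lemma r_le1 x : r x <= 1.
Proof.
rewrite -(@expr_le1 _ 2) // r_sqr; case: (degree G x) => [|n]; first by rewrite invr0.
by rewrite invf_le1 // ler1n.
Qed.

Lemma killed_mx_tr : A^T = A.
Proof. by apply/matrixP => i j; rewrite !mxE edge_sym mulrC. Qed.

Lemma sum_edge_le x : r x ^+ 2 * \sum_(z <- s) (edge x z)%:R <= 1.
Proof.
rewrite r_sqr; have [->|deg0] := eqVneq (degree G x) 0%N.
  by rewrite invr0 mul0r.
rewrite mulrC ler_pdivrMr ?ltr0n ?lt0n // mul1r -natr_sum ler_nat.
rewrite (eq_bigr (fun z => if edge x z then 1 else 0)%N) => [|z _]; last by case: edge.
rewrite -big_mkcond sum1_count -size_filter /degree.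
have finE : finite_set [set z | G z /\ adj x z].
  by apply: (sub_finite_set _ (finite_dist1_ball x 1)) => z [_ /eqP /= ->].
apply: uniq_leq_size => [|z]; first exact: filter_uniq.
rewrite mem_filter => /andP[/andP[/asboolP[_ Gz] xz] _].
by rewrite in_fset_set // inE.
Qed.

(** On each edge the product of [r (pt i) * v i 0] and [r (pt j) * v j 0] is at most the mean of
    their squares. Each square is then counted at most degree many times, which its factor [r ^+ 2]
    compensates. *)
Lemma killed_mx_contraction (v : 'cV[R]_N.+1) :
  `|(v^T *m A *m v) 0 0| <= (v^T *m v) 0 0.
Proof.
have -> : (v^T *m A *m v) 0 0 = \sum_i \sum_j v i 0 * A i j * v j 0.
  rewrite mxE exchange_big; apply: eq_bigr => j _; rewrite mxE mulr_suml.
  by apply: eq_bigr => i _; rewrite mxE.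
have -> : (v^T *m v) 0 0 = \sum_i v i 0 ^+ 2.
  by rewrite mxE; apply: eq_bigr => i _; rewrite mxE expr2.
pose w i j : R := (edge (pt i) (pt j))%:R * (r (pt i) * v i 0) ^+ 2.
apply: (@le_trans _ _ (\sum_i \sum_j (w i j + w j i) / 2)).
  apply: (le_trans (ler_norm_sum _ _ _)); apply: ler_sum => i _.
  apply: (le_trans (ler_norm_sum _ _ _)); apply: ler_sum => j _.
  rewrite mxE /w edge_sym; case: edge;
    last by rewrite !(mulr0, mul0r) addr0 mul0r normr0.
  have := sqr_ge0 (r (pt i) * v i 0 - r (pt j) * v j 0).
  have := sqr_ge0 (r (pt i) * v i 0 + r (pt j) * v j 0).
  rewrite ler_norml !mul1r; set p := r _ * v i 0; set q := r _ * v j 0.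
  have -> : v i 0 * (r (pt i) * r (pt j)) * v j 0 = p * q by rewrite /p /q; ring.
  by move=> ? ?; apply/andP; split; nra.
have -> : \sum_i \sum_j (w i j + w j i) / 2 = \sum_i \sum_j w i j.
  under eq_bigr do rewrite -mulr_suml big_split.
  by rewrite -mulr_suml big_split /= [X in (_ + X) / _]exchange_big /=; field.
apply: ler_sum => i _.
have -> : \sum_j w i j = r (pt i) ^+ 2 * (\sum_(z <- s) (edge (pt i) z)%:R) * v i 0 ^+ 2.
  rewrite -sum_pt mulr_sumr mulr_suml; apply: eq_bigr => j _.
  by rewrite /w exprMn; ring.
by rewrite ler_piMl ?sqr_ge0 ?sum_edge_le.
Qed.

Lemma killed_mx_range k i j : (k < dist1 (pt i) (pt j))%N -> (A ^+ k) i j = 0.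
Proof.
elim: k i => [|k IHk] i kD.
  by rewrite expr0 mxE; case: eqP kD => // ->; rewrite dist1xx.
rewrite exprS -mulmxE mxE big1 // => l _; rewrite mxE; case: ifP => [|_];
  last by rewrite mul0r.
move=> /andP[_ /eqP il]; rewrite IHk ?mulr0 //.
by have := dist1_triangle (pt l) (pt i) (pt j); rewrite il; move: kD; lia.
Qed.

(** Within k steps the walk cannot leave [s], so the killing is invisible. The conjugation is stated
    without division because [r] vanishes at isolated vertices. *)
Lemma walk_kernel_killed k i j :
  (forall z, (dist1 (pt i) z <= k)%N -> z \in s) ->
  walk_kernel R G k (pt i) (pt j) * r (pt j) = (A ^+ k) i j * r (pt i).
Proof.
elim: k i => [|k IHk] i ball_s.
  rewrite expr0 mxE /= /pt nth_uniq ?s_size ?ltn_ord // -val_eqE /=.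
  by case: eqP => [/val_inj ->|]; rewrite ?mul0r.
rewrite walk_kernelS exprS -mulmxE mxE !mulr_suml.
have -> : \sum_(z <- nbrs (pt i)) step R G (pt i) z * walk_kernel R G k z (pt j) * r (pt j)
  = \sum_(z <- s) step R G (pt i) z * walk_kernel R G k z (pt j) * r (pt j).
  rewrite [RHS](bigID (adj (pt i))) /= [X in _ = _ + X]big1 ?addr0 => [|z /negPf iz].
    rewrite -[RHS]big_filter; apply: perm_big; apply: uniq_perm.
    - exact: fset_uniq.
    - exact: filter_uniq.
    - move=> z; rewrite mem_filter mem_nbrs; apply/idP/andP => [iz|[]//]; split=> //.
      by apply: ball_s; move: iz => /eqP ->.
  by rewrite /step iz andbF !mul0r.
rewrite -sum_pt; apply: eq_bigr => l _; rewrite mxE /step -/(edge _ _).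
case: ifP => [il|_]; last by rewrite !mul0r.
rewrite -mulrA IHk => [|z lz]; first by rewrite -r_sqr; ring.
apply: ball_s; apply: leq_trans (dist1_triangle (pt l) _ _) _.
by move: il => /andP[_ /eqP ->]; rewrite add1n ltnS.
Qed.

End killed_walk.

Lemma ball_enumeration d (x y : Zd d) n :
  exists (N : nat) (s : seq (Zd d)) (i j : 'I_N.+1),
  [/\ uniq s, size s = N.+1, nth 0 s i = x, nth 0 s j = y &
    forall z, (dist1 x z <= n)%N \/ (dist1 y z <= n)%N -> z \in s].
Proof.
pose F := fset_set ([set z | (dist1 x z <= n)%N] `|` [set z | (dist1 y z <= n)%N]).
have FE z : (z \in F) = (dist1 x z <= n)%N || (dist1 y z <= n)%N.
  rewrite /F in_fset_set; last by rewrite finite_setU; split; exact: finite_dist1_ball.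
  by apply/idP/orP; rewrite inE.
have xF : x \in enum_fset F by have : x \in F by rewrite FE dist1xx.
have yF : y \in enum_fset F by have : y \in F by rewrite FE dist1xx orbT.
have sF : size (enum_fset F) = (size (enum_fset F)).-1.+1.
  by case: (enum_fset F) xF.
have idx z : z \in enum_fset F -> (index z (enum_fset F) < (size (enum_fset F)).-1.+1)%N.
  by move=> zF; rewrite -sF index_mem.
exists (size (enum_fset F)).-1, (enum_fset F), (Ordinal (idx x xF)), (Ordinal (idx y yF)).
split; rewrite ?nth_index ?fset_uniq //.
by move=> z /orP; rewrite -FE.
Qed.

Section heat_kernel.
Variables (R : realType) (d : nat) (G : set (Zd d)).

(** [s] covers the balls around both points, so one symmetric matrix represents the kernel in both
    directions; [c] is the product of the inverse square roots of the two degrees. *)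
Lemma heat_kernel_killed x y n : exists (N : nat) (s : seq (Zd d)) (i j : 'I_N.+1),
  [/\ uniq s, size s = N.+1, nth 0 s i = x & nth 0 s j = y] /\
  exists2 c : R, 0 <= c <= 1 &
    heat_kernel R G n x y = (killed_mx R G N s ^+ n) i j * c /\
    heat_kernel R G n y x = (killed_mx R G N s ^+ n) i j * c.
Proof.
have [N [s [i [j [s_uniq s_size ix jy ball_s]]]]] := ball_enumeration x y n.
exists N, s, i, j; split => //.
pose r (x : Zd d) : R := (Num.sqrt (degree G x)%:R)^-1.
have r0 z : 0 <= r z by rewrite invr_ge0 sqrtr_ge0.
pose pt (k : 'I_N.+1) : Zd d := nth 0 s k.
have hk k l m : (forall z, (dist1 (pt k) z <= m)%N -> z \in s) ->
    heat_kernel R G m (pt k) (pt l) =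
    (killed_mx R G N s ^+ m) k l * (r (pt k) * r (pt l)).
  move=> ball_k; have := walk_kernel_killed R G s_uniq s_size l ball_k.
  rewrite -/(r _) -/(r _) => wk.
  have -> : heat_kernel R G m (pt k) (pt l) =
      walk_kernel R G m (pt k) (pt l) * r (pt l) * r (pt l).
    by rewrite /heat_kernel -mulrA -expr2 /r exprVn sqr_sqrtr.
  by rewrite wk; ring.
exists (r x * r y); first by rewrite mulr_ge0 ?mulr_ile1 ?r_le1.
have tr_exp m : ((killed_mx R G N s) ^+ m)^T = (killed_mx R G N s) ^+ m.
  rewrite -[X in X ^+ m](horner_mx_X) -rmorphXn; apply: horner_mx_tr.
  exact: killed_mx_tr.
rewrite -ix -jy -/(pt i) -/(pt j); split; first by rewrite hk // => z;
  rewrite /pt ix => xz; apply: ball_s; left.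
rewrite hk; first by rewrite -[in LHS]tr_exp mxE [r _ * r _]mulrC.
by move=> z; rewrite /pt jy => yz; apply: ball_s; right.
Qed.

Lemma heat_kernel_sym n x y : heat_kernel R G n x y = heat_kernel R G n y x.
Proof. by have [N [s [i [j [_ [c _ [-> ->]]]]]]] := heat_kernel_killed x y n. Qed.

Lemma heat_kernel_far n x y : (n < dist1 x y)%N -> heat_kernel R G n x y = 0.
Proof.
have [N [s [i [j [[s_uniq s_size <- <-] [c _ [-> _]]]]]]] := heat_kernel_killed x y n.
by move=> xy; rewrite killed_mx_range ?mul0r.
Qed.

Lemma heat_kernel_le n x y : (0 < dist1 x y <= n)%N ->
  heat_kernel R G n x y <= 2 * expR (- ((dist1 x y)%:R ^+ 2 / (8 * n%:R))).
Proof.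
have [N [s [i [j [[s_uniq s_size ix jy] [c /andP[c0 c1] [-> _]]]]]]] := heat_kernel_killed x y n.
move=> /andP[D0 Dn]; set D := dist1 x y in D0 Dn *.
apply: (@le_trans _ _ `|(killed_mx R G N s ^+ n) i j|).
  apply: le_trans (ler_norm _) _; rewrite normrM (ger0_norm c0) ler_piMr //.
have n0 : 0 < n%:R :> R by rewrite ltr0n (leq_trans D0).
(* With this [l] the exponent - l D + 2 n l^2 equals - D^2 / (8 n), and D <= n gives the condition l
   <= 1/4 of [cosh_le]. *)
pose l : R := D%:R / (4 * n%:R).
have l0 : 0 <= l by rewrite divr_ge0 // mulr_ge0 // ltW.
have l1 : l <= 1 / 4.
  rewrite ler_pdivrMr ?mulr_gt0 // (_ : 1 / 4 * (4 * n%:R) = n%:R) ?ler_nat //.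
  by field.
have far k : (k < D)%N -> (killed_mx R G N s ^+ k) i j = 0.
  by move=> kD; apply: killed_mx_range; rewrite // ix jy.
apply: le_trans (carne_varopoulos (killed_mx_tr R G N s)
  (killed_mx_contraction G s_uniq s_size) n far l0) _.
have cosh0 : 0 <= (expR l + expR (- l)) / 2 by rewrite divr_ge0 // addr_ge0 ?expR_ge0.
rewrite -mulrA ler_wpM2l //.
apply: (@le_trans _ _ (expR (- (l * D%:R)) * expR (2 * l ^+ 2) ^+ n)).
  rewrite ler_wpM2l ?expR_ge0 // lerXn2r ?nnegrE ?expR_ge0 // cosh_le //.
  by rewrite l0.
rewrite -expRM_natl -expRD ler_expR le_eqVlt; apply/orP; left; apply/eqP.
by rewrite /l; field; rewrite gt_eqF.
Qed.

End heat_kernel.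

(** * Summation of the heat kernel bounds *)

Section sums.
Variable R : realType.
Implicit Types (p a : nat -> R).

Lemma powR_half (x : R) d : 0 <= x ->
  x `^ (- (d%:R / 2)) = (Num.sqrt x)^-1 ^+ d.
Proof.
move=> x0; rewrite powRN mulrC powRrM powR12_sqrt // powR_mulrn ?sqrtr_ge0 //.
by rewrite exprVn.
Qed.

Lemma exprz_2subn (x : R) d : x != 0 -> x ^ (2 - d%:Z) = x ^+ 2 * x^-1 ^+ d.
Proof. by move=> x0; rewrite expfzDr // exprVn -exprnP exprnN. Qed.

(** The exponential series dominates its term of degree d + 1. With v = D / sqrt n this turns
    n^(-d/2) e^(- c D^2 / n) into a bound of order D^-d, uniform in n. *)
Lemma power_gaussian_bounded (c : R) d : 0 < c ->
  exists2 K, 0 < K & forall v, 0 <= v -> v ^+ d * expR (- (c * v ^+ 2)) <= K.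
Proof.
move=> c0; pose f : R := d.+1`!%:R; exists (1 + f / c ^+ d.+1).
  by rewrite addr_gt0 // divr_gt0 ?exprn_gt0 // ltr0n fact_gt0.
move=> v v0; set z := c * v ^+ 2.
have z0 : 0 <= z by rewrite mulr_ge0 ?sqr_ge0 // ltW.
rewrite expRN ler_pdivrMr ?expR_gt0 //.
have f0 : 0 < f by rewrite ltr0n fact_gt0.
have := expR_ge1Dxn d z0; rewrite -/f => ez.
have e1 : 1 <= expR z by rewrite -[leLHS]expR0 ler_expR.
have vd : v ^+ d <= 1 + (v ^+ 2) ^+ d.+1.
  have [v1|v1] := lerP v 1.
    by apply: (le_trans (exprn_ile1 d v0 v1)); rewrite lerDl exprn_ge0 ?sqr_ge0.
  rewrite -exprM -[leLHS]add0r lerD // ler_weXn2l ?ltW //; lia.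
apply: (le_trans vd).
have -> : (v ^+ 2) ^+ d.+1 = f / c ^+ d.+1 * (z ^+ d.+1 / f).
  have : 0 < c ^+ d.+1 by rewrite exprn_gt0.
  have -> : z ^+ d.+1 = c ^+ d.+1 * (v ^+ 2) ^+ d.+1 by exact: exprMn.
  set a := c ^+ _; set b := (v ^+ 2) ^+ _ => a0.
  by rewrite [RHS]mulrC mulrA divfK ?gt_eqF // mulrAC divff ?mul1r // gt_eqF.
rewrite mulrDl mul1r lerD //; apply: ler_wpM2l.
  by rewrite divr_ge0 ?exprn_ge0 // ltW.
by lra.
Qed.

(** For q = sqrt n and q' = sqrt (n + 1) this bounds n^(-3/2) by a telescoping difference, replacing
    a comparison with an integral. *)
Lemma inv_sqrt_cube_le (q q' : R) : 1 <= q -> 0 < q' -> q' ^+ 2 = q ^+ 2 + 1 ->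
  q^-1 ^+ 3 <= 4 * (q^-1 - q'^-1).
Proof.
move=> q1 q'0 qq'; have q0 : 0 < q by lra.
have qltq' : 0 < q + q' by lra.
have -> : q^-1 - q'^-1 = (q * q' * (q + q'))^-1.
  have : (q' - q) * (q + q') = 1.
    by transitivity (q' ^+ 2 - q ^+ 2); [ring|rewrite qq'; ring].
  move=> e; rewrite -[(q * q' * _)^-1]mul1r -e; field.
  by rewrite !gt_eqF.
have h : q' * (q + q') <= 4 * q ^+ 2.
  by have := sqr_ge0 (q' - q); rewrite mulrDr -expr2 qq'; nra.
rewrite exprVn -[4 * _]mulrC -ler_pdivrMr // -invfM lef_pV2 ?posrE ?mulr_gt0 ?exprn_gt0 //.
by have := ler_wpM2l (ltW q0) h; congr (_ <= _); ring.
Qed.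

Lemma sum_le_telescope p a (B c : R) L M :
  (forall n, 0 <= p n) -> (forall n, 0 <= a n) -> 0 <= c ->
  (forall n, (n < L)%N -> p n <= B) ->
  (forall n, (L <= n)%N -> p n <= c * (a n - a n.+1)) ->
  \sum_(n < M) p n <= L%:R * B + c * a L.
Proof.
move=> p0 a0 c0 pB pa.
apply: (@le_trans _ _ (\sum_(n < L + M) p n)).
  by rewrite addnC big_split_ord /= lerDl sumr_ge0.
rewrite big_split_ord /= lerD //.
  apply: le_trans (ler_sum _ (fun (i : 'I_L) _ => pB i (ltn_ord i))) _.
  by rewrite sumr_const card_ord mulr_natl.
apply: le_trans (ler_sum _ (fun (i : 'I_M) _ => pa (L + i)%N (leq_addr _ _))) _.
rewrite -mulr_sumr ler_wpM2l //.
have -> : \sum_(i < M) (a (L + i)%N - a (L + i).+1) = a L - a (L + M)%N.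
  elim: M => [|M IHM]; first by rewrite big_ord0 addn0 subrr.
  by rewrite big_ord_recr /= IHM addnS addrA subrK.
by rewrite lerBlDr lerDl.
Qed.

(** By parity only p_n + p_(n+1) has a lower bound; summing these pairs counts each term at most
    twice. *)
Lemma sum_pairs_le p L : (forall n, 0 <= p n) ->
  \sum_(i < L) (p (L + i)%N + p (L + i).+1) <= 2 * \sum_(n < L + L.+1) p n.
Proof.
move=> p0; rewrite big_split /= mulr_natl mulr2n; apply: lerD.
  rewrite -addSnnS addSn big_ord_recr /= big_split_ord /=.
  by rewrite -addrA addrCA lerDl addr_ge0 // sumr_ge0.
rewrite big_split_ord /= big_ord_recl /= addrA.
under [X in _ <= _ + X]eq_bigr do rewrite /bump /= add1n addnS.
by rewrite lerDr addr_ge0 // sumr_ge0.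
Qed.

End sums.

Lemma p_kernelE (R : realType) d dT (T : measurableType dT) (G : set (Zd d))
    (P : Zd d -> probability T R) (X : nat -> T -> Zd d) x y n :
  is_srw G x (P x) X -> p_kernel G P X n x y = heat_kernel R G n x y.
Proof.
move=> [mX lawX]; rewrite /p_kernel /heat_kernel; congr (_ / _).
have -> : P x (X n @^-1` [set y]) = (walk_kernel R G n x y)%:E; last by [].
rewrite -[walk_kernel _ _ _ _ _]mul1r; apply: (walk_law (mu := P x) mX) => // s.
by rewrite mul1r; exact: lawX.
Qed.

(** * Two-sided bounds for the sum of heat kernels *)

Section green_estimates.
Variables (R : realType) (d : nat).

Lemma time_condition (tau : \bar R) (D n : nat) : (0 < D)%N ->
  (tau * (1 + (8 * d%:R) * ln D%:R)%:E <= (D%:R ^+ 2)%:E)%E ->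
  (D ^ 2 <= n)%N -> (tau <= n%:R%:E)%E.
Proof.
move=> D0 tauD Dn.
have lnD : 0 <= ln D%:R :> R by rewrite ln_ge0 // ler1n.
have f1 : 1 <= 1 + 8 * d%:R * ln D%:R :> R by rewrite lerDl !mulr_ge0.
have Dn' : D%:R ^+ 2 <= n%:R :> R by rewrite -natrX ler_nat.
(* [tau] may be negative or infinite: the value +oo contradicts [tauD], and for nonpositive values
   the conclusion is immediate. *)
case: tau tauD => [t||] /=.
- rewrite -EFinM !lee_fin => tD; apply: le_trans Dn'; have [t0|t0] := lerP t 0.
    by apply: (le_trans t0); rewrite sqr_ge0.
  by apply: le_trans tD; rewrite ler_peMr // ltW.
- by rewrite gt0_mulye ?lte_fin ?(lt_le_trans _ f1) // leye_eq.
- by rewrite leNye.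
Qed.

(** Origin of the constant 8 d: n (1 + 8 d log D) <= D^2 forces D^2 / (8 n) >= d log D. *)
Lemma early_time (tau : \bar R) (D n : nat) : (0 < D)%N -> (0 < n)%N ->
  (tau * (1 + (8 * d%:R) * ln D%:R)%:E <= (D%:R ^+ 2)%:E)%E ->
  (n%:R%:E < tau)%E ->
  expR (- (D%:R ^+ 2 / (8 * n%:R))) <= D%:R^-1 ^+ d :> R.
Proof.
move=> D0 n0 tauD ntau.
have lnD : 0 <= ln D%:R :> R by rewrite ln_ge0 // ler1n.
set f : R := 1 + _ in tauD.
have f1 : 1 <= f by rewrite lerDl !mulr_ge0.
have D_gt0 : 0 < D%:R :> R by rewrite ltr0n.
have n_gt0 : 0 < n%:R :> R by rewrite ltr0n.
have nf : n%:R * f <= D%:R ^+ 2.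
  rewrite -lee_fin EFinM; apply: le_trans tauD; apply: lee_wpmul2r; last exact: ltW.
  by rewrite lee_fin (le_trans _ f1).
have -> : D%:R^-1 ^+ d = expR (- (d%:R * ln D%:R)) :> R.
  by rewrite expRN expRM_natl lnK ?posrE // exprVn.
rewrite ler_expR lerN2 ler_pdivlMr ?mulr_gt0 //; apply: le_trans nf.
by rewrite /f; nra.
Qed.

Lemma heat_kernel_sum_le (c1 c2 : R) :
  (3 <= d)%N -> 0 < c1 -> 0 < c2 -> exists2 C : R, 0 < C &
  forall (D : nat) (tau : \bar R) (p : nat -> R), (0 < D)%N ->
    (forall n, 0 <= p n) ->
    (forall n, (n < D)%N -> p n = 0) ->
    (forall n, (D <= n)%N -> p n <= 2 * expR (- (D%:R ^+ 2 / (8 * n%:R)))) ->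
    (forall n, (D <= n)%N -> (tau <= n%:R%:E)%E ->
      p n <= c1 * n%:R `^ (- (d%:R / 2)) * expR (- (c2 * D%:R ^+ 2 / n%:R))) ->
    (tau * (1 + (8 * d%:R) * ln D%:R)%:E <= (D%:R ^+ 2)%:E)%E ->
    forall M, \sum_(n < M) p n <= C * D%:R ^ (2 - d%:Z).
Proof.
move=> d3 c1_gt0 c2_gt0; have [K K0 gaussK] := power_gaussian_bounded d c2_gt0.
(* 2 comes from the times before [tau], [c1 * K] from those between [tau] and D^2, and [4 * c1] from
   the telescoped tail. *)
exists (2 + c1 * K + 4 * c1); first by rewrite !addr_gt0 ?mulr_gt0.
move=> D tau p D0 p0 p_far p_early p_late tauD M.
have D_gt0 : 0 < D%:R :> R by rewrite ltr0n.
have D1 : 1 <= D%:R :> R by rewrite ler1n.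
pose q n : R := Num.sqrt n%:R.
have q_gt0 n : (0 < n)%N -> 0 < q n by move=> n0; rewrite sqrtr_gt0 ltr0n.
have qq n : q n ^+ 2 = n%:R by rewrite sqr_sqrtr.
have qD : q (D ^ 2)%N = D%:R by rewrite /q natrX sqrtr_sqr ger0_norm // ltW.
pose B := (2 + c1 * K) * D%:R^-1 ^+ d; pose c := 4 * c1 * D%:R^-1 ^+ (d - 3).
have c_ge0 : 0 <= c by rewrite !mulr_ge0 ?exprn_ge0 ?invr_ge0 // ltW.
have sumM : \sum_(n < M) p n <= (D ^ 2)%:R * B + c * (q (D ^ 2)%N)^-1.
  apply: (@sum_le_telescope _ p (fun n => (q n)^-1)) => // [n|n nD|n Dn].
  - by rewrite invr_ge0 sqrtr_ge0.
  - have [nD'|Dn] := ltnP n D.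
      rewrite p_far // mulr_ge0 ?exprn_ge0 ?invr_ge0 // ?ltW //.
      by rewrite addr_gt0 // mulr_gt0.
    have n0 : (0 < n)%N by apply: leq_trans Dn.
    rewrite /B mulrDl; case: (leP tau n%:R%:E) => [taun|ntau].
      rewrite -[leLHS]add0r lerD ?mulr_ge0 ?exprn_ge0 ?invr_ge0 ?ler0n //.
      apply: (le_trans (p_late n Dn taun)); rewrite powR_half // -/(q n).
      have Dq0 : 0 <= D%:R / q n by rewrite divr_ge0 ?ler0n ?(ltW (q_gt0 _ _)).
      have -> : (q n)^-1 ^+ d = D%:R^-1 ^+ d * (D%:R / q n) ^+ d.
        by rewrite -exprMn mulKf ?gt_eqF.
      have -> : c2 * D%:R ^+ 2 / n%:R = c2 * (D%:R / q n) ^+ 2.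
        by rewrite expr_div_n qq -[LHS]mulrA.
      have := gaussK _ Dq0; set g := _ ^+ d; set e := expR _; set i := _ ^+ d => gK.
      have i0 : 0 <= i by rewrite exprn_ge0 ?invr_ge0 ?ler0n.
      rewrite (_ : c1 * (i * g) * e = c1 * i * (g * e)); last by ring.
      rewrite (_ : c1 * K * i = c1 * i * K); last by ring.
      by rewrite ler_wpM2l // mulr_ge0 // ltW.
    apply: (le_trans (p_early n Dn)); rewrite -[leLHS]addr0 lerD //.
      by rewrite ler_pM2l // (early_time D0 n0 tauD ntau).
    by rewrite !mulr_ge0 ?exprn_ge0 ?invr_ge0 ?ler0n // ltW.
  - have n0 : (0 < n)%N by apply: leq_trans Dn; rewrite expn_gt0 D0.
    have DleqD2 : (D <= D ^ 2)%N by rewrite expnS expn1 leq_pmulr.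
    have Dn' := leq_trans DleqD2 Dn.
    apply: (le_trans (p_late n Dn' (time_condition D0 tauD Dn))).
    rewrite powR_half // -/(q n) -mulrA /c.
    apply: (@le_trans _ _ (c1 * (q n)^-1 ^+ d)).
      rewrite ler_pM2l // ler_piMr ?exprn_ge0 ?invr_ge0 ?(ltW (q_gt0 _ _)) //.
      by rewrite -[leRHS]expR0 ler_expR oppr_le0 divr_ge0 // mulr_ge0 ?sqr_ge0 // ltW.
    have Dq : D%:R <= q n.
      by rewrite -qD ler_sqrt ?ler_nat // ltr0n.
    (* Here d >= 3 enters: n^(-d/2) is n^(-(d-3)/2), at most D^-(d-3) since n >= D^2, times the
       summable n^(-3/2). *)
    rewrite -{1}(subnK d3) exprD.
    apply: (@le_trans _ _ (c1 * (D%:R^-1 ^+ (d - 3) * (4 * ((q n)^-1 - (q n.+1)^-1))))); last first.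
      by rewrite le_eqVlt; apply/orP; left; apply/eqP; ring.
    rewrite ler_pM2l //; apply: ler_pM;
      rewrite ?exprn_ge0 ?invr_ge0 ?(ltW (q_gt0 _ _)) //.
      by rewrite lerXn2r ?nnegrE ?invr_ge0 ?(ltW (q_gt0 _ _)) ?ler0n // lef_pV2 ?posrE ?q_gt0.
    apply: inv_sqrt_cube_le; rewrite ?q_gt0 ?(le_trans D1) //.
    by rewrite !qq -natr1.
apply: (le_trans sumM); rewrite qD exprz_2subn ?gt_eqF // natrX /B /c.
have key : D%:R^-1 ^+ (d - 3) * D%:R^-1 = D%:R ^+ 2 * D%:R^-1 ^+ d :> R.
  by rewrite -[in RHS](subnK d3) exprD; field; rewrite gt_eqF.
rewrite -[4 * c1 * _ * _]mulrA key le_eqVlt; apply/orP; left; apply/eqP; ring.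
Qed.

Lemma heat_kernel_sum_ge (c3 c4 : R) : 0 < c3 -> 0 < c4 -> exists2 C : R, 0 < C &
  forall (D : nat) (tau : \bar R) (p : nat -> R), (0 < D)%N ->
    (forall n, 0 <= p n) ->
    (forall n, (0 < n)%N -> (tau <= n%:R%:E)%E -> D%:R `^ (3 / 2) <= n%:R :> R ->
      c3 * n%:R `^ (- (d%:R / 2)) * expR (- (c4 * D%:R ^+ 2 / n%:R)) <=
        p n + p n.+1) ->
    (tau * (1 + (8 * d%:R) * ln D%:R)%:E <= (D%:R ^+ 2)%:E)%E ->
    C * D%:R ^ (2 - d%:Z) <= \sum_(n < D ^ 2 + (D ^ 2).+1) p n.
Proof.
move=> c3_gt0 c4_gt0; exists (c3 * 2^-1 ^+ d * expR (- c4) / 2).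
  by rewrite divr_gt0 ?mulr_gt0 ?exprn_gt0 ?expR_gt0 ?invr_gt0.
move=> D tau p D0 p0 p_late tauD.
have D_gt0 : 0 < D%:R :> R by rewrite ltr0n.
have D2_gt0 : (0 < D ^ 2)%N by rewrite expn_gt0 D0.
pose b : R := c3 * (2 * D%:R)^-1 ^+ d * expR (- c4).
have pb (i : 'I_(D ^ 2)) : b <= p (D ^ 2 + i)%N + p (D ^ 2 + i).+1.
  have Dn : (D ^ 2 <= D ^ 2 + i)%N by exact: leq_addr.
  (* A cap by a perfect square bounds sqrt n by 2 D, whence the factor [2^-1 ^+ d] of the
     constant. *)
  have nD : (D ^ 2 + i <= (2 * D) ^ 2)%N.
    by rewrite expnMn; have := ltn_ord i; lia.
  move: (D ^ 2 + i)%N Dn nD => n Dn nD.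
  have n0 : (0 < n)%N by exact: leq_trans Dn.
  have n_gt0 : 0 < n%:R :> R by rewrite ltr0n.
  have D2n : D%:R ^+ 2 <= n%:R :> R by rewrite -natrX ler_nat.
  apply: le_trans (p_late n n0 (time_condition D0 tauD Dn) _); last first.
    apply: le_trans D2n; rewrite -powR_mulrn ?ler0n // ler_powR ?ler1n //.
    by rewrite ler_pdivrMr // -natrM ler_nat.
  rewrite /b powR_half // ler_pM ?mulr_ge0 ?exprn_ge0 ?invr_ge0 ?expR_ge0 ?(ltW c3_gt0) //.
    rewrite ler_pM2l // lerXn2r ?nnegrE ?invr_ge0 ?sqrtr_ge0 // ?mulr_ge0 //.
    rewrite lef_pV2 ?posrE ?sqrtr_gt0 ?mulr_gt0 //.
    rewrite -[leRHS]ger0_norm ?mulr_ge0 // -sqrtr_sqr ler_sqrt ?sqr_ge0 //.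
    by rewrite -natrM -natrX ler_nat.
  by rewrite ler_expR lerN2 ler_pdivrMr // ler_pM2l.
have : \sum_(i < D ^ 2) b <= 2 * \sum_(n < D ^ 2 + (D ^ 2).+1) p n.
  by apply: le_trans (sum_pairs_le (D ^ 2) p0); apply: ler_sum => i _; exact: pb.
rewrite sumr_const card_ord -[b *+ _]mulr_natl natrX exprz_2subn ?gt_eqF // /b invfM exprMn.
set s := \sum_(n < _) _ => bs; rewrite -(ler_pM2l (ltr0Sn _ 1)).
by apply: le_trans bs; rewrite le_eqVlt; apply/orP; left; apply/eqP; field.
Qed.

End green_estimates.

Theorem theorem1p17 (R : realType) (d : nat) (a b : R)
    (P : R -> probability (Omega d) R) (DeltaS : R -> R) (u : R)
    (* the discrete and the continuous time walks X and Y, with laws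
       PX w x and QY w x when started at x in S_oo w *)
    (dX dY : measure_display) (TX : measurableType dX) (TY : measurableType dY)
    (X : nat -> TX -> Zd d) (PX : Omega d -> Zd d -> probability TX R)
    (Y : R -> TY -> Zd d) (QY : Omega d -> Zd d -> probability TY R)
    (Ohk : set (Omega d)) (Thk : Zd d -> Omega d -> \bar R) :
  (3 <= d)%N -> 0 < a -> a < b ->
  P1 a b P -> P2 a b P -> P3 a b P -> S1 a b P DeltaS -> S2 a b P ->
  a < u < b ->
  (forall w x, S_oo R w x -> is_srw (S_oo R w) x (PX w x) X) ->
  (forall w x, S_oo R w x -> is_ctsrw (S_oo R w) x (QY w x) Y) ->
  quenched_hk_bounds (P u) (DeltaS u)
    (fun w => p_kernel (S_oo R w) (PX w) X)
    (fun w => q_kernel (S_oo R w) (QY w) Y) Ohk Thk ->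
  exists C1 C2 C3 : R, [/\ 0 < C1, 0 < C2 & 0 < C3] /\
    forall w, Ohk w -> forall x y, S_oo R w x -> S_oo R w y -> x != y ->
      (Order.min (Thk x w) (Thk y w) * (1 + C3 * ln (dist1 x y)%:R)%:E
         <= ((dist1 x y)%:R ^+ 2)%:E)%E ->
      ((C1 * (dist1 x y)%:R ^ (2 - d%:Z))%:E
         <= green (S_oo R w) (QY w) Y x y)%E /\
      (green (S_oo R w) (QY w) Y x y
         <= (C2 * (dist1 x y)%:R ^ (2 - d%:Z))%:E)%E.
Proof.
move=> d3 _ _ _ _ _ _ _ _ srwX ctsrwY [_ [_ [_ [c1 [c2 [c3 [c4 [c [C hk]]]]]]]]].
case: hk => -[c1_gt0 c2_gt0 c3_gt0 c4_gt0] [_ [hk _]].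
have [C2 C2_gt0 upper] := heat_kernel_sum_le d3 c1_gt0 c2_gt0.
have [C1 C1_gt0 lower] := heat_kernel_sum_ge d c3_gt0 c4_gt0.
exists C1, C2, (8 * d%:R); split.
  by split=> //; rewrite mulr_gt0 // ltr0n (leq_trans _ d3).
move=> w Ow.
pose S x y : \bar R := (\sum_(n <oo) (heat_kernel R (S_oo R w) n x y)%:E)%E.
have bounds x y : S_oo R w x -> S_oo R w y -> x != y ->
    (Thk x w * (1 + (8 * d%:R) * ln (dist1 x y)%:R)%:E
       <= ((dist1 x y)%:R ^+ 2)%:E)%E ->
    ((C1 * (dist1 x y)%:R ^ (2 - d%:Z))%:E <= S x y)%E /\
    (S x y <= (C2 * (dist1 x y)%:R ^ (2 - d%:Z))%:E)%E.
  move=> Sx Sy xy TD.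
  have D0 : (0 < dist1 x y)%N by rewrite lt0n dist1_eq0.
  pose p n := heat_kernel R (S_oo R w) n x y.
  have p0 n : 0 <= p n by exact: heat_kernel_ge0.
  have pK n : p_kernel (S_oo R w) (PX w) X n x y = p n by apply: p_kernelE; exact: srwX.
  (* Among the variants in [hk], the discrete kernel with the l1-distance is selected, at integer
     times. *)
  have gauss n : (0 < n)%N -> (Thk x w <= n%:R%:E)%E ->
      gaussian_bounds d c1 c2 c3 c4 n%:R (p n + p n.+1) (dist1 x y)%:R%:E.
    move=> n0 Tn; have [_ hkx] := hk w Ow x Sx.
    apply: (hkx _ _ Tn y Sy _ _ _ (or_intror erefl)); first by rewrite ltr0n.
    by right; rewrite natrK !pK.
  split.
    have low := lower _ _ p D0 p0 _ TD.
    apply: (@le_trans _ _ (\sum_(n < dist1 x y ^ 2 + (dist1 x y ^ 2).+1) p n)%:E).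
      rewrite lee_fin; apply: low => n n0 Tn Dn.
      have [_ gl] := gauss n n0 Tn; apply: gl.
      by rewrite poweR_EFin lee_fin.
    rewrite -sumEFin -(big_mkord xpredT (fun n => (p n)%:E)).
    by apply: nneseries_lim_ge => n _ _; rewrite lee_fin.
  apply: lime_le; first by apply: is_cvg_nneseries => n _ _; rewrite lee_fin; exact: p0.
  apply: nearW => M; rewrite big_mkord sumEFin lee_fin.
  apply: (upper _ _ _ D0 p0 _ _ _ TD) => n Dn.
  - exact: heat_kernel_far.
  - by apply: heat_kernel_le; rewrite D0.
  - move=> Tn; have n0 := leq_trans D0 Dn.
    have [gu _] := gauss n n0 Tn; apply: le_trans (gu _).
      by rewrite lerDl.
    by rewrite lee_fin ler_nat.
move=> x y Sx Sy xy.
have -> : green (S_oo R w) (QY w) Y x y = S x y.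
  exact: green_series y (ctsrwY w x Sx).
rewrite minEle; case: ifP => _ TD; first exact: bounds.
(* When the minimum is attained at [y], the endpoints are exchanged in the series, where symmetry
   holds term by term. *)
have -> : S x y = S y x by apply: eq_eseriesr => n _; rewrite heat_kernel_sym.
by move: TD; rewrite dist1_sym; apply: bounds; rewrite // eq_sym.
Qed.
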